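(* Fix $t\in\mathbb N$ and let $\mathfrak{gl}^M$ be the Mackey Lie algebra of a diagonalizable pairing $V\otimes V_*\to\mathbb C$ with $\dim V=\aleph_t$. The radical filtration of the adjoint $\mathfrak{gl}^M$-module is given by $$\mathrm{rad}^1\mathfrak{gl}^M=\mathbb C\,\mathrm{id}_V\oplus\mathfrak{gl}^M_t,\qquad \mathrm{rad}^{s+1}\mathfrak{gl}^M=\mathfrak{gl}^M_{t-s}\ \text{ for } s=1,\dots,t,\qquad \mathrm{rad}^{t+2}\mathfrak{gl}^M=\mathfrak{sl}(V,V_* ).$$
   Context: The ground field is $\mathbb C$, $\otimes=\otimes_{\mathbb C}$, $\mathbb N$ contains $0$. $V$ is a vector space with basis $\{v_b:b\in\mathcal B\}$, $|\mathcal B|=\aleph_t$; $V^*=\mathrm{Hom}(V,\mathbb C)$; $x_b\in V^*$ is defined by $x_b(v_a)=\delta_{ab}$; $V_*:=\mathrm{span}\{x_b:b\in\mathcal B\}\subset V^*$; $\mathbf p:V\otimes V_*\to\mathbb C$ is the evaluation pairing. The Mackey Lie algebra is $\mathfrak{gl}^M:=\{\varphi\in\mathrm{End}(V):\varphi^*(V_* )\subset V_*\}$ with the commutator bracket, where $\varphi^*$ is the dual endomorphism of $V^*$. $\mathfrak{sl}(V,V_* ):=\ker\mathbf p\subset V\otimes V_*\subset\mathfrak{gl}^M$. Identify $V^*$ with $\mathrm{Maps}(\mathcal B,\mathbb C)$ via $x\mapsto(b\mapsto x(v_b))$; for $0\le s\le t+1$ let $V^*_s\subset V^*$ be the subspace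 of those $x$ whose support $\{b: x(v_b)\ne0\}$ has cardinality $<\aleph_s$. Set $\mathfrak{gl}^M_s:=\{\varphi\in\mathfrak{gl}^M:\varphi^*(V^* )\subset V^*_s\}$, an ideal; $\mathfrak{gl}^M_0=V\otimes V_*$ and $\mathfrak{gl}^M_{t+1}=\mathfrak{gl}^M$. The radical $\mathrm{rad}M$ of a module $M$ is the joint kernel of all homomorphisms from $M$ to simple quotients; $\mathrm{rad}^1M=\mathrm{rad}M$ and $\mathrm{rad}^qM=\mathrm{rad}(\mathrm{rad}^{q-1}M)$. *)

(* Defs.v *)
From HB Require Import structures.
From mathcomp Require Import all_boot all_algebra.
From mathcomp Require Import boolp classical_sets functions cardinality reals.
From mathcomp Require Export complex.

Set Implicit Arguments.
Unset Strict Implicit.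
Unset Printing Implicit Defensive.

Import GRing.Theory.
Local Open Scope classical_set_scope.
Local Open Scope ring_scope.

Definition card_lt T U (A : set T) (B : set U) : Prop :=
  (A #<= B)%card /\ ~ (B #<= A)%card.

(* [has_aleph n A] is |A| = aleph_n: aleph_0 is the cardinality of nat, and
   aleph_{n+1} is the least cardinality strictly above aleph_n. *)
Fixpoint has_aleph (n : nat) (T : Type) (A : set T) : Prop :=
  if n is n'.+1 then
    exists U (K : set U), [/\ has_aleph n' K, card_lt K A
      & forall W (C : set W), card_lt K C -> (A #<= C)%card]
  else (A #= [set: nat])%card.

Definition lt_aleph (n : nat) T (A : set T) : Prop :=
  exists U (K : set U), has_aleph n K /\ card_lt A K.

HB.mixin Record Lmodule_isLieAlgebra (K : fieldType) (L : Type)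
    of GRing.Lmodule K L := {
  lie : L -> L -> L;
  lie_linearl : forall y, linear (fun x => lie x y);
  lie_linearr : forall x, linear (lie x);
  liexx : forall x, lie x x = 0;
  lie_jacobi : forall x y z,
    lie x (lie y z) + lie y (lie z x) + lie z (lie x y) = 0 }.

#[short(type="lieAlgType")]
HB.structure Definition LieAlgebra (K : fieldType) :=
  { L of Lmodule_isLieAlgebra K L & GRing.Lmodule K L }.

HB.mixin Record Lmodule_isLieModule (K : fieldType) (L : lieAlgType K)
    (M : Type) of GRing.Lmodule K M := {
  lieact : L -> M -> M;
  lieact_linearl : forall m, linear (fun g => lieact g m);
  lieact_linearr : forall g, linear (lieact g);
  lieact_lie : forall g h m,
    lieact (lie g h) m = lieact g (lieact h m) - lieact h (lieact g m) }.

#[short(type="lieModType")]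
HB.structure Definition LieModule (K : fieldType) (L : lieAlgType K) :=
  { M of Lmodule_isLieModule K L M & GRing.Lmodule K M }.

Section LieModules.
Context {K : fieldType} {L : lieAlgType K}.

Definition submodule (M : lieModType L) (N : set M) : Prop :=
  [/\ N 0, (forall a x y, N x -> N y -> N (a *: x + y))
    & forall g x, N x -> N (lieact g x)].

Definition simple_module (S : lieModType L) : Prop :=
  (exists x : S, x != 0) /\
  forall N : set S, submodule N -> N = [set 0] \/ N = setT.

(* Homomorphism from the submodule [N] of [M] to [S]; the values of [f]
   outside [N] are irrelevant. *)
Definition module_hom_on (M S : lieModType L) (N : set M) (f : M -> S) : Prop :=
  (forall a x y, N x -> N y -> f (a *: x + y) = a *: f x + f y) /\
  (forall g x, N x -> f (lieact g x) = lieact g (f x)).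

(* A homomorphism to a simple module is zero or surjective, so the simple
   modules that matter here are the simple quotients of [N]. *)
Definition rad (M : lieModType L) (N : set M) : set M :=
  [set x | N x /\ forall (S : lieModType L) (f : M -> S),
                    simple_module S -> module_hom_on N f -> f x = 0].

Definition radn (M : lieModType L) (q : nat) : set M := iter q (@rad M) setT.

End LieModules.
Arguments radn {K L} M q.

Definition is_direct_sum (K : fieldType) (M : lmodType K) (N A B : set M) :=
  N = [set a + b | a in A & b in B] /\ A `&` B = [set 0].

(* [L] acting on itself by [g . m = lie g m]. *)
Definition adjoint (K : fieldType) (L : lieAlgType K) : Type := L.

Section Adjoint.
Variables (K : fieldType) (L : lieAlgType K).
HB.instance Definition _ := GRing.Lmodule.on (adjoint L).

Fact lieC (x y : L) : lie x y = - lie y x.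
Proof.
have lD (u v w : L) : lie (u + v) w = lie u w + lie v w.
  by have := lie_linearl w 1 u v; rewrite !scale1r.
have rD (u v w : L) : lie u (v + w) = lie u v + lie u w.
  by have := lie_linearr u 1 v w; rewrite !scale1r.
have := liexx (x + y); rewrite lD !rD !liexx add0r addr0.
by move/eqP; rewrite addr_eq0 => /eqP.
Qed.

Fact lieNr (x y : L) : lie x (- y) = - lie x y.
Proof.
have r0 : lie x 0 = 0.
  have := lie_linearr x 1 0 0; rewrite !scale1r addr0.
  by rewrite -[X in X = _]addr0 => /addrI.
by have := lie_linearr x (-1) y 0; rewrite !addr0 r0 addr0 !scaleN1r.
Qed.

Fact adjoint_lie (g h m : L) :
  lie (lie g h) m = lie g (lie h m) - lie h (lie g m).
Proof.
have := lie_jacobi g h m; rewrite [lie m (lie g h)]lieC => /eqP.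
by rewrite subr_eq0 => /eqP <-; rewrite [lie m g]lieC lieNr.
Qed.

HB.instance Definition _ := Lmodule_isLieModule.Build K L (adjoint L)
  (@lie_linearl K L) (@lie_linearr K L) adjoint_lie.
End Adjoint.

Definition is_basis (K : fieldType) (V : lmodType K) (B : choiceType)
    (v : B -> V) : Prop :=
  (forall (s : seq B) (c : B -> K), uniq s ->
     \sum_(b <- s) c b *: v b = 0 -> {in s, forall b, c b = 0}) /\
  (forall u : V, exists (s : seq B) (c : B -> K), u = \sum_(b <- s) c b *: v b).

Section Mackey.
Variables (K : fieldType) (V : lmodType K) (B : choiceType).
Implicit Types (v : B -> V) (x : B -> {scalar V}) (y : {scalar V}).

Definition dual_family v x : Prop := forall a b, x b (v a) = (a == b)%:R.

(* V_*, the span of the [x b] inside V^* = {scalar V} *)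
Definition Vlow x : set {scalar V} :=
  [set y | exists s : seq (K * B), forall u, y u = \sum_(p <- s) p.1 * x p.2 u].

(* V^*_s *)
Definition Vdual v (s : nat) : set {scalar V} :=
  [set y | lt_aleph s [set b | y (v b) != 0]].

Definition dual_end (phi : {linear V -> V}) (y : {scalar V}) : {scalar V} :=
  y \o phi.

Definition mackey x : {pred V -> V} := fun phi =>
  `[< exists2 f : {linear V -> V}, phi = f
        & forall y, Vlow x y -> Vlow x (dual_end f y) >].

Record glM x := GlM { glM_val :> V -> V; _ : glM_val \in mackey x }.

Section Instances.
Variable x : B -> {scalar V}.

HB.instance Definition _ := [isSub for @glM_val x].
HB.instance Definition _ := [Choice of glM x by <:].

Fact Vlow_comb (a b : K) (y1 y2 y3 : {scalar V}) :
  Vlow x y1 -> Vlow x y2 -> (forall u, y3 u = a * y1 u + b * y2 u) ->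
  Vlow x y3.
Proof.
move=> [s1 e1] [s2 e2] e3.
exists ([seq (a * p.1, p.2) | p <- s1] ++ [seq (b * p.1, p.2) | p <- s2]) => u.
rewrite big_cat /= !big_map e3 e1 e2 !mulr_sumr.
by congr (_ + _); apply: eq_bigr => p _; rewrite mulrA.
Qed.

Fact mackeyP (phi : V -> V) : phi \in mackey x <-> linear phi /\
  forall y y', Vlow x y -> (forall u, y' u = y (phi u)) -> Vlow x y'.
Proof.
split=> [/asboolP[f -> hf]|[lphi hphi]].
  split=> [|y y' /hf [s es] e]; first exact: linearP.
  by exists s => u; rewrite e -es.
pose phiL := GRing.isLinear.Build K V V *:%R phi lphi.
pose f : {linear V -> V} := HB.pack phi phiL.
apply/asboolP; exists f => // y hy; exact: hphi hy _.
Qed.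

Fact mackey_submod : submod_closed (mackey x).
Proof.
split=> [|a phi psi /mackeyP[lphi hphi] /mackeyP[lpsi hpsi]]; apply/mackeyP.
  split=> [c u w|y y' _ e]; first by change (0 = c *: 0 + 0 :> V);
    rewrite scaler0 addr0.
  exists [::] => u; rewrite big_nil e; exact: linear0.
split=> [c u w|y y' hy e].
  change (a *: phi (c *: u + w) + psi (c *: u + w)
          = c *: (a *: phi u + psi u) + (a *: phi w + psi w)).
  rewrite lphi lpsi !scalerDr !scalerA [a * c]mulrC.
  by rewrite -!addrA; congr (_ + _); rewrite addrCA.
pose phiL := GRing.isLinear.Build K V V *:%R phi lphi.
pose psiL := GRing.isLinear.Build K V V *:%R psi lpsi.
pose f : {linear V -> V} := HB.pack phi phiL.
pose g : {linear V -> V} := HB.pack psi psiL.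
have hf : Vlow x (dual_end f y) by exact: hphi hy _.
have hg : Vlow x (dual_end g y) by exact: hpsi hy _.
apply: (Vlow_comb (a := a) (b := 1) hf hg) => u; rewrite e mul1r.
change (y (a *: phi u + psi u) = a * y (phi u) + y (psi u)).
by rewrite linearP.
Qed.
HB.instance Definition _ := GRing.isSubmodClosed.Build K (V -> V) (mackey x)
  mackey_submod.
HB.instance Definition _ := [SubChoice_isSubLmodule of glM x by <:].

Fact glM_linear (phi : glM x) : linear phi.
Proof. by case: phi => phi /= /mackeyP[]. Qed.
HB.instance Definition _ (phi : glM x) :=
  GRing.isLinear.Build K V V *:%R phi (glM_linear phi).

Fact glM_dual (phi : glM x) y : Vlow x y -> Vlow x (dual_end phi y).
Proof. by move=> hy; have /mackeyP[_] := valP phi; apply; [exact: hy|]. Qed.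

Fact mackey_lie (phi psi : glM x) : (phi \o psi) - (psi \o phi) \in mackey x.
Proof.
apply/mackeyP; split=> [a u w|y y' hy e].
  change (phi (psi (a *: u + w)) - psi (phi (a *: u + w))
    = a *: (phi (psi u) - psi (phi u)) + (phi (psi w) - psi (phi w))).
  by rewrite !glM_linear scalerBr opprD addrACA.
have h1 := glM_dual psi (glM_dual phi hy).
have h2 := glM_dual phi (glM_dual psi hy).
apply: (Vlow_comb (a := 1) (b := -1) h1 h2) => u; rewrite e mul1r mulN1r.
by change (y (phi (psi u) - psi (phi u)) = y (phi (psi u)) - y (psi (phi u)));
  rewrite linearB.
Qed.

Definition glM_lie (phi psi : glM x) : glM x := GlM (mackey_lie phi psi).

Fact glM_ext (phi psi : glM x) : phi =1 psi -> phi = psi.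
Proof. by move=> /funext e; apply: val_inj. Qed.

Fact glM_addE (p q : glM x) u : (p + q) u = p u + q u.
Proof. by []. Qed.
Fact glM_scaleE a (p : glM x) u : (a *: p) u = a *: p u.
Proof. by []. Qed.
Fact glM_zeroE u : (0 : glM x) u = 0.
Proof. by []. Qed.
Fact glM_lieE (p q : glM x) u : glM_lie p q u = p (q u) - q (p u).
Proof. by []. Qed.
Let glME := (glM_addE, glM_scaleE, glM_zeroE, glM_lieE).

Fact glM_lier (phi : glM x) : linear (glM_lie phi).
Proof.
move=> a p q; apply: glM_ext => u; rewrite !glME glM_linear scalerBr opprD.
by rewrite addrACA.
Qed.

Fact glM_liel (psi : glM x) : linear (fun phi => glM_lie phi psi).
Proof.
move=> a p q; apply: glM_ext => u; rewrite !glME glM_linear scalerBr opprD.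
by rewrite addrACA.
Qed.

Fact glM_liexx (phi : glM x) : glM_lie phi phi = 0.
Proof. by apply: glM_ext => u; rewrite !glME subrr. Qed.

Fact glM_jacobi (p q r : glM x) :
  glM_lie p (glM_lie q r) + glM_lie q (glM_lie r p) + glM_lie r (glM_lie p q)
  = 0.
Proof.
have fB (g : glM x) (u w : V) : g (u - w) = g u - g w by exact: linearB.
have h (w1 w2 w3 w4 : V) : w1 - w2 - (w3 - w4) = (w1 - w3) + (w4 - w2).
  by rewrite opprB [w4 - w3]addrC addrACA [- w2 + _]addrC.
have k (a1 a2 a3 b1 b2 b3 : V) : a1 + b1 + (a2 + b2) + (a3 + b3)
    = a1 + a2 + a3 + (b1 + b2 + b3).
  by rewrite (addrACA a1) (addrACA (a1 + a2)).
apply: glM_ext => u; rewrite !glME !fB !h k.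
by rewrite !subrKA !subrr addr0.
Qed.

HB.instance Definition _ := Lmodule_isLieAlgebra.Build K (glM x)
  glM_liel glM_lier glM_liexx glM_jacobi.

Fact mackey_id : idfun \in mackey x.
Proof.
by apply/mackeyP; split=> // y y' [s es] e; exists s => u; rewrite e -es.
Qed.

Definition glM_id : glM x := GlM mackey_id.

(* gl^M_s *)
Definition glM_ideal v (s : nat) : set (glM x) :=
  [set phi | forall y, Vdual v s (dual_end phi y)].

(* sl(V, V_* ), the kernel of the evaluation pairing: a tensor is a finite sum of
   pure tensors of [w i] in V with [y i] in V_*; it acts on V as
   [u |-> \sum_i y i u *: w i] and its evaluation is [\sum_i y i (w i)]. *)
Definition slV : set (glM x) :=
  [set phi | exists n (w : 'I_n -> V) (y : 'I_n -> {scalar V}),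
    [/\ forall i, Vlow x (y i), forall u, phi u = \sum_i y i u *: w i
      & \sum_i y i (w i) = 0]].

End Instances.
End Mackey.
Arguments slV {K V B} x.

(* Main.v *)
(* The ideals of gl^M are governed by how far an operator is from the scalars.
   If an ideal contains [phi] and no [phi - c id] has fewer than aleph_s nonzero
   columns, a maximal sparse family of pairs (a, b) of indices on which [phi] is
   not scalar has at least aleph_s members, and compressing [phi] and its
   commutators to it puts a sum of aleph_s disjoint off-diagonal matrix units
   in the ideal. Commutators then give every operator with at most aleph_s
   nonzero columns and disjoint row and column supports, and an Eilenberg
   swindle removes the disjointness. So every gl^M_(s+1), and gl^M modulo
   scalars, has a largest proper submodule, which is its radical; the summand
   C id of rad gl^M is trivial and does not affect the next step. For gl^M_0 the
   same argument with a single matrix unit yields sl(V, V_* ). *)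
From HB Require Import structures.
Require Import Defs.
From mathcomp Require Import all_boot all_algebra.
From mathcomp Require Import boolp classical_sets functions cardinality.
From mathcomp Require Import reals complex.
Import GRing.Theory.

Set Implicit Arguments.
Unset Strict Implicit.
Unset Printing Implicit Defensive.

Local Open Scope classical_set_scope.
Local Open Scope ring_scope.

(** * Cardinals *)

Section Cardinals.
Local Open Scope card_scope.

(** [rad] quantifies over homomorphisms to abstract simple modules, so an upper bound for it
    requires genuine simple quotients; this is why [N / P] is constructed. The radical is then the
    intersection of the maximal submodules. The sum of C id and gl^M_t has no largest proper
    submodule: both gl^M_t and C id plus the next term of the filtration are maximal, and
    intersecting the two is what removes the scalars.

    The counting rests on the fact that operators in gl^M have finite rows as well as finite
    columns. An index interacts with finitely many others, so the indices touched by a family are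
    finitely many or no more numerous than the family. Hence a maximal family without interactions
    already determines the operator up to a scalar and few columns.

    Disjointness of rows and columns is needed because a commutator consists of two products: an
    operator is recovered from one of them only if the other vanishes. Division by 2 enters in the
    same way, when one of two opposite corners is isolated. *)

Lemma fun_card_le T U (A : set T) (B : set U) (f : T -> U) :
  (forall a, A a -> B (f a)) ->
  (forall a a', A a -> A a' -> f a = f a' -> a = a') -> A #<= B.
Proof.
move=> fAB finj.
have finj' : {in A &, injective f}.
  by move=> a a' /set_mem Aa /set_mem Aa'; exact: finj.
apply: card_le_trans (_ : f @` A #<= B).
  by rewrite (card_le_eqr (inj_card_eq finj')).
by apply: subset_card_le => _ [a Aa <-]; exact: fAB.
Qed.

Lemma rel_card_le T U (A : set T) (B : set U) (r : T -> U -> Prop) :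
  (forall a, A a -> exists2 b, B b & r a b) ->
  (forall a a' b, A a -> A a' -> r a b -> r a' b -> a = a') -> A #<= B.
Proof.
move=> rAB rinj; have [->|/set0P[a0 Aa0]] := eqVneq A set0;
  first exact: card_ge0.
have [b0 _ _] := rAB _ Aa0.
have /choice[f fP] : forall a, exists b, A a -> B b /\ r a b.
  move=> a; have [Aa|nAa] := pselect (A a); last by exists b0.
  by have [b Bb rab] := rAB _ Aa; exists b.
apply: (@fun_card_le _ _ _ _ f) => [a /fP[]//|a a' Aa Aa' e].
apply: (rinj _ _ (f a) Aa Aa'); first by case: (fP _ Aa).
by rewrite e; case: (fP _ Aa').
Qed.

Lemma card_le_fun T U (A : set T) (B : set U) (u0 : U) : A #<= B ->
  exists f : T -> U, (forall a, A a -> B (f a)) /\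
    (forall a a', A a -> A a' -> f a = f a' -> a = a').
Proof.
elim/Ppointed: U => U in B u0 *; first by case: (no u0).
move=> /pcard_leP[f]; exists f; split=> [a Aa|a a' Aa Aa' e]; first exact: funS.
by apply: (@inj _ _ _ f); rewrite ?inE.
Qed.

(** The form in which Zorn's lemma is used throughout: whatever is left out of [E] meets a member of
    it. The alternative [j = i] also covers an empty [F i], which meets nothing. *)
Lemma maximal_disjoint T I (F : I -> set T) (D : set I) :
  exists E, [/\ E `<=` D, trivIset E F &
    forall i, D i -> exists2 j, E j & j = i \/ F i `&` F j !=set0].
Proof.
have [E [ED tE maxE]] := ex_maximal_disjoint_subcollection F D.
exists E; split=> // i Di; apply: contrapT => nE.
have nEi : ~ E i by move=> Ei; apply: nE; exists i => //; left.
have disj j : E j -> ~ (F i `&` F j !=set0).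
  by move=> Ej h; apply: nE; exists j => //; right.
apply: (maxE (E `|` [set i])).
- by split=> [p|/(_ i) h]; [left|apply: nEi; apply: h; right].
- by move=> j [/ED|->].
move=> j k [Ej|->] [Ek|->] //; first exact: tE.
- by rewrite setIC => /(disj _ Ej).
- by move=> /(disj _ Ek).
Qed.

(** A disjoint family of the two-point sets [F (a, b)] is a partial matching between [A] and [B]; a
    maximal one exhausts one of the sides. *)
Lemma card_le_total T U (A : set T) (B : set U) : A #<= B \/ B #<= A.
Proof.
pose F (p : T * U) : set (T + U) := [set z | z = inl p.1 \/ z = inr p.2].
have [E [EAB tE maxE]] := maximal_disjoint F (A `*` B).
have dE p q z : E p -> E q -> F p z -> F q z -> p = q.
  by move=> h h' f f'; apply: (tE _ _ h h'); exists z.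
have [hA|/existsNP[a /not_implyP[Aa nEa]]] :=
    pselect (forall a, A a -> exists b, E (a, b)).
  left; apply: (@rel_card_le _ _ _ _ (fun a b => E (a, b))).
    by move=> a /hA[b Eab]; exists b => //; case: (EAB _ Eab).
  move=> a a' b _ _ h h'.
  by case: (dE _ _ (inr b) h h' (or_intror erefl) (or_intror erefl)).
right; apply: (@rel_card_le _ _ _ _ (fun b a => E (a, b))); last first.
  move=> b b' a' _ _ h h'.
  by case: (dE _ _ (inl a') h h' (or_introl erefl) (or_introl erefl)).
move=> b Bb; have [[a' b'] Ep h] := maxE (a, b) (conj Aa Bb).
exists a'; first by case: (EAB _ Ep).
have na : a' <> a by move=> e; apply: nEa; exists b'; rewrite -e.
case: h => [[/na//]|[z [/= [->|->] []]]] // [e]; last by rewrite e.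
by case: na.
Qed.

Lemma card_leX T U W (A : set T) (B : set U) (C : set W) :
  A #<= B -> A `*` C #<= B `*` C.
Proof.
have [->|/set0P[a0 Aa0]] := eqVneq A set0; first by rewrite set0X.
move=> AB; have [u0] : inhabited U.
  apply: contrapT => nU; have B0 : B = set0.
    by apply/seteqP; split=> u // _; apply: nU; split.
  by move: AB Aa0; rewrite B0 => /card_le0P ->.
have [f [fB finj]] := card_le_fun u0 AB.
apply: (@fun_card_le _ _ _ _ (fun p => (f p.1, p.2))).
  by move=> [a c] [/= Aa Cc]; split=> //; exact: fB.
by move=> [a c] [a' c'] [/= Aa _] [/= Aa' _] [e ->]; rewrite (finj a a').
Qed.

(** A maximal disjoint family of countably infinite subsets misses only finitely many points of [A].
    Each member absorbs a factor nat by the pairing of natural numbers. *)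
Lemma infinite_mul_nat T (A : set T) : infinite_set A ->
  A `*` [set: nat] #<= A.
Proof.
move=> /infiniteP iA.
pose D : set (set T) := [set C | C `<=` A /\ C #= [set: nat]].
have [E [ED tE maxE]] := maximal_disjoint id D.
pose A0 := \bigcup_(C in E) C.
have A0A : A0 `<=` A by move=> x [C /ED[CA _]] /CA.
have finA : finite_set (A `\` A0).
  apply: contrapT => /infiniteP/card_subP[C CN CA].
  have [x Cx] : C !=set0.
    by apply: infinite_setN0; apply/infiniteP; case/card_eqPle: CN.
  have DC : D C by split=> // y /CA[].
  have [C' EC' [CC'|[y [/= Cy C'y]]]] := maxE _ DC.
    by case: (CA _ Cx) => _ []; exists C' => //; rewrite CC'.
  by case: (CA _ Cy) => _ []; exists C'.
have A0N : A0 `*` [set: nat] #<= A0.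
  have /choice[f fP] : forall C : set T, exists f : T -> nat, E C ->
      (forall x y, C x -> C y -> f x = f y -> x = y) /\
      (forall n, exists2 x, C x & f x = n).
    move=> C; have [/ED[_ /pcard_eqP[f]]|nE] := pselect (E C); last first.
      by exists (fun=> 0%N).
    exists f => _; split=> [x y Cx Cy|n]; first by apply: inj; rewrite inE.
    by have [x Cx e] := @surj _ _ _ _ f n I; exists x.
  apply: (@rel_card_le _ _ _ _ (fun p y => exists C, [/\ E C, C p.1, C y &
     f C y = pickle (f C p.1, p.2)])).
    move=> [x n] [[C EC Cx] _]; have [_ h] := fP _ EC.
    have [y Cy e] := h (pickle (f C x, n)).
    by exists y; [exists C|exists C].
  move=> [x n] [x' n'] y _ _ [C [EC /= Cx Cy e]] [C' [EC' /= Cx' Cy' e']].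
  have eC : C = C' by apply: tE => //; exists y.
  rewrite -{C'}eC in EC' Cx' Cy' e'.
  have [h _] := fP _ EC.
  by move: (pcan_inj pickleK (etrans (esym e) e')) => -[/(h _ _ Cx Cx') -> ->].
have AA0 : A #<= A0.
  apply: card_le_trans A0N.
  have [a1 A0a1] : A0 !=set0.
    apply/set0P/eqP => A00; move: finA; rewrite A00 setD0.
    exact/infiniteP.
  have /countable_injP[g ginj] := finite_set_countable finA.
  (* Label 0 is reserved for [A0]; the finite remainder gets positive labels over the single point
     [a1]. *)
  apply: (@fun_card_le _ _ _ _
     (fun x => if `[< A0 x >] then (x, 0%N) else (a1, (g x).+1))).
    by move=> a Aa; case: asboolP.
  move=> a a' Aa Aa'; case: asboolP => h; case: asboolP => h' // [] //.
  by apply: ginj; rewrite inE.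
apply: card_le_trans (card_leX _ AA0) _; apply: card_le_trans A0N _.
exact: subset_card_le.
Qed.

(** Numbering the elements of each [N a] embeds the union in the product of [A] with nat. *)
Lemma card_bigcup_finite T U (A : set T) (N : T -> set U) : infinite_set A ->
  (forall a, A a -> finite_set (N a)) -> \bigcup_(a in A) N a #<= A.
Proof.
move=> iA fN; apply: card_le_trans (infinite_mul_nat iA).
have /choice[g gP] : forall a, exists g : U -> nat, A a ->
    {in N a &, injective g}.
  move=> a; have [/fN/finite_set_countable/countable_injP[g gi]|nAa] :=
    pselect (A a); first by exists g.
  by exists (fun=> 0%N).
apply: (@rel_card_le _ _ _ _ (fun u p => [/\ A p.1, N p.1 u & g p.1 u = p.2])).
  by move=> u [a Aa Nau]; exists (a, g a u).
move=> u u' [a n] _ _ [/= Aa Nu <-] [_ Nu' /esym].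
by apply: gP => //; rewrite inE.
Qed.

End Cardinals.

(** * Comparison with the alephs *)

Section Alephs.
Local Open Scope card_scope.

Lemma card_lt_NleP T U (A : set T) (B : set U) : card_lt A B <-> ~ (B #<= A).
Proof. by split=> [[]//|h]; split=> //; case: (card_le_total A B). Qed.

Lemma has_aleph_infinite n T (A : set T) : has_aleph n A -> infinite_set A.
Proof.
elim: n T A => [|n IH] T A /=; first by move=> /card_eqPle[_ /infiniteP].
move=> [U [K [/IH/infiniteP iK [KA _] _]]]; apply/infiniteP.
exact: card_le_trans KA.
Qed.

(** Induction on the minimality of the successor cardinal. It makes the choice of the set hidden in
    [lt_aleph] irrelevant. *)
Lemma has_aleph_le n T U (A : set T) (B : set U) :
  has_aleph n A -> has_aleph n B -> A #<= B.
Proof.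
elim: n T U A B => [|n IH] T U A B.
  by move=> /card_eqPle[AN _] /card_eqPle[_]; exact: card_le_trans.
move=> [V [K [aK KA minA]]] [W [L [aL LB minB]]]; apply: minA.
apply/card_lt_NleP => BK; case: LB => _; apply.
by apply: card_le_trans BK _; exact: IH.
Qed.

Lemma lt_alephP n T U (K : set T) (A : set U) : has_aleph n K ->
  lt_aleph n A <-> ~ (K #<= A).
Proof.
move=> aK; split=> [[W [L [aL [_ LA]]]] KA|nKA].
  by apply: LA; apply: card_le_trans KA; exact: has_aleph_le aL aK.
by exists T, K; split=> //; exact/card_lt_NleP.
Qed.

Lemma lt_aleph_le n T U (K : set T) (A : set U) : has_aleph n K ->
  lt_aleph n A -> A #<= K.
Proof. by move=> aK /(lt_alephP _ aK); case: (card_le_total A K). Qed.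

Lemma lt_aleph_has n T (A : set T) : lt_aleph n A ->
  exists U (K : set U), has_aleph n K.
Proof. by move=> [U [K [aK _]]]; exists U, K. Qed.

Lemma lt_aleph_card_le n T U (A : set T) (B : set U) : A #<= B ->
  lt_aleph n B -> lt_aleph n A.
Proof.
move=> AB ltB; have [W [K aK]] := lt_aleph_has ltB.
apply/(lt_alephP _ aK) => KA; move/(lt_alephP _ aK): ltB; apply.
exact: card_le_trans AB.
Qed.

Lemma lt_aleph_sub n T (A B : set T) : A `<=` B -> lt_aleph n B -> lt_aleph n A.
Proof. by move=> AB; apply: lt_aleph_card_le; exact: subset_card_le. Qed.

(** [lt_aleph n] asserts that some set has cardinality aleph_n, hence the witness [K]. *)
Lemma finite_lt_aleph n T U (K : set U) (A : set T) : has_aleph n K ->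
  finite_set A -> lt_aleph n A.
Proof.
move=> aK fA; apply/(lt_alephP _ aK) => KA.
by apply: (has_aleph_infinite aK); exact: card_le_finite fA.
Qed.

Lemma lt_aleph0P T (A : set T) : lt_aleph 0 A <-> finite_set A.
Proof.
have aN : has_aleph 0 [set: nat] by exact: card_eqxx.
split=> [/(lt_alephP _ aN)|]; last exact: finite_lt_aleph aN.
by rewrite finite_setPn.
Qed.

Lemma lt_alephS n T U (K : set T) (A : set U) : has_aleph n K ->
  lt_aleph n.+1 A -> A #<= K.
Proof.
move=> aK [W [L [[X [M [aM _ minL]]] /card_lt_NleP nLA]]].
have [//|KA] := card_le_total A K; apply: contrapT => nAK.
apply: nLA; apply: minL; apply/card_lt_NleP => AM; apply: nAK.
apply: card_le_trans AM _; exact: has_aleph_le aM aK.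
Qed.

Lemma card_le_lt_alephS n T U W (K : set T) (L : set W) (A : set U) :
  has_aleph n K -> has_aleph n.+1 L -> A #<= K -> lt_aleph n.+1 A.
Proof.
move=> aK aL AK; apply/(lt_alephP _ aL) => LA.
case: aL => X [M [aM [_ nLM] _]]; apply: nLM.
apply: card_le_trans LA _; apply: card_le_trans AK _; exact: has_aleph_le aK aM.
Qed.

Lemma has_aleph_below n m T (A : set T) : (m <= n)%N -> has_aleph n A ->
  exists U (K : set U), has_aleph m K /\ K #<= A.
Proof.
elim: n T A => [|n IH] T A.
  by rewrite leqn0 => /eqP-> aA; exists T, A; split.
rewrite leq_eqVlt => /predU1P[->|]; first by exists T, A; split.
rewrite ltnS => mn [U [K [aK [KA _] _]]].
have [W [L [aL LK]]] := IH _ _ mn aK.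
by exists W, L; split=> //; exact: card_le_trans KA.
Qed.

Lemma lt_aleph_bigcup n T U (A : set T) (N : T -> set U) : lt_aleph n A ->
  (forall a, A a -> finite_set (N a)) -> lt_aleph n (\bigcup_(a in A) N a).
Proof.
move=> ltA fN; have [fA|iA] := pselect (finite_set A).
  have [W [K aK]] := lt_aleph_has ltA.
  by apply: (finite_lt_aleph aK); exact: bigcup_finite.
by apply: lt_aleph_card_le ltA; exact: card_bigcup_finite.
Qed.

(** The smaller set is absorbed by attaching to each point of the larger one its finite fibre under
    an injection; the union becomes one of finite sets. *)
Lemma lt_alephU n T (A A' : set T) :
  lt_aleph n A -> lt_aleph n A' -> lt_aleph n (A `|` A').
Proof.
wlog le : A A' / A #<= A'.
  move=> h lA lA'; have [le|le] := card_le_total A A'; first exact: h.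
  by rewrite setUC; exact: h.
move=> lA lA'; have [->|/set0P[a0 Aa0]] := eqVneq A set0;
  first by rewrite set0U.
have [f [fA' finj]] := card_le_fun a0 le.
have fin a : A' a -> finite_set ([set a] `|` [set b | A b /\ f b = a]).
  move=> _; rewrite finite_setU; split; first exact: finite_set1.
  have [[b [Ab fb]]|nb] := pselect (exists b, A b /\ f b = a).
    apply: sub_finite_set (finite_set1 b) => b' [Ab' fb'].
    by apply: finj => //; rewrite fb.
  by apply: sub_finite_set (finite_set0 T) => b h; apply: nb; exists b.
apply: lt_aleph_sub (lt_aleph_bigcup lA' fin) => b [Ab|A'b].
  by exists (f b); [exact: fA'|right].
by exists b => //; left.
Qed.

End Alephs.

(** * Radicals and maximal submodules *)

Section Submodules.
Variables (K : fieldType) (L : lieAlgType K) (M : lieModType L).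
Implicit Types (N P Q : set M) (x y : M).

Lemma lieactD g x y : lieact g (x + y) = lieact g x + lieact g y.
Proof. by have := lieact_linearr g 1 x y; rewrite !scale1r. Qed.

Lemma lieact0 g : lieact g (0 : M) = 0.
Proof. by apply: (addIr (lieact g 0)); rewrite -lieactD !add0r. Qed.

Lemma lieactZ g a x : lieact g (a *: x) = a *: lieact g x.
Proof. by have := lieact_linearr g a x 0; rewrite lieact0 !addr0. Qed.

Lemma lieactB g x y : lieact g (x - y) = lieact g x - lieact g y.
Proof. by rewrite lieactD -scaleN1r lieactZ scaleN1r. Qed.

Lemma submod0 N : submodule N -> N 0. Proof. by case. Qed.

Lemma submodD N x y : submodule N -> N x -> N y -> N (x + y).
Proof. by move=> [_ h _] Nx Ny; have := h 1 x y Nx Ny; rewrite scale1r. Qed.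

Lemma submodZ N a x : submodule N -> N x -> N (a *: x).
Proof. by move=> [h0 h _] Nx; have := h a x 0 Nx h0; rewrite addr0. Qed.

Lemma submodN N x : submodule N -> N x -> N (- x).
Proof. by move=> hN Nx; rewrite -scaleN1r; exact: submodZ. Qed.

Lemma submodB N x y : submodule N -> N x -> N y -> N (x - y).
Proof. by move=> hN Nx Ny; apply: submodD => //; exact: submodN. Qed.

Lemma submod_act N g x : submodule N -> N x -> N (lieact g x).
Proof. by move=> [_ _]; apply. Qed.

Lemma submodule_addset N P : submodule N -> submodule P ->
  submodule [set x + y | x in N & y in P].
Proof.
move=> hN hP; split.
- by exists 0; [exact: submod0|exists 0; [exact: submod0|rewrite addr0]].
- move=> a _ _ [x Nx [y Py <-]] [x' Nx' [y' Py' <-]].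
  exists (a *: x + x'); first by case: hN => _ + _; apply.
  exists (a *: y + y'); first by case: hP => _ + _; apply.
  by rewrite scalerDr addrACA.
- move=> g _ [x Nx [y Py <-]]; exists (lieact g x); first exact: submod_act.
  by exists (lieact g y); [exact: submod_act|rewrite lieactD].
Qed.

Lemma submoduleI N P : submodule N -> submodule P -> submodule (N `&` P).
Proof.
move=> [N0 Nl Na] [P0 Pl Pa]; split; first by split.
  by move=> a x y [Nx Px] [Ny Py]; split; [exact: Nl|exact: Pl].
by move=> g x [Nx Px]; split; [exact: Na|exact: Pa].
Qed.

Lemma submoduleT : submodule [set: M]. Proof. by split. Qed.

Definition maximal_submodule N P :=
  [/\ submodule P, P `<=` N, ~ (N `<=` P) &
    forall Q, submodule Q -> P `<=` Q -> Q `<=` N -> Q `<=` P \/ N `<=` Q].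

End Submodules.

(* The quotient [N / P], carried by canonical representatives: [repr_mod x]
   depends only on the coset of [x] modulo [P]. *)
Section Quotient.
Variables (K : fieldType) (L : lieAlgType K) (M : lieModType L) (N P : set M).
Variables (hN : submodule N) (hP : submodule P) (PN : P `<=` N).

Definition repr_mod (x : M) : M := xget 0 [set y | P (x - y)].
Local Notation r := repr_mod.

Lemma repr_modP x : P (x - r x).
Proof.
rewrite /r; case: xgetP => [y ->//|/(_ x)].
by rewrite /= subrr => /(_ (submod0 hP)).
Qed.

Lemma eq_repr_mod x y : P (x - y) -> r x = r y.
Proof.
move=> Pxy; rewrite /r; congr xget; apply/seteqP; split=> z /= h.
  by have := submodB hP h Pxy; rewrite opprB addrC subrKA.
by have := submodD hP Pxy h; rewrite subrKA.
Qed.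

Lemma repr_modK x : r (r x) = r x.
Proof. by apply/esym/eq_repr_mod/repr_modP. Qed.

Lemma repr_modDl x y : r (r x + y) = r (x + y).
Proof.
apply/esym/eq_repr_mod; rewrite opprD addrACA subrr addr0; exact: repr_modP.
Qed.

Lemma repr_modDr x y : r (x + r y) = r (x + y).
Proof. by rewrite addrC repr_modDl addrC. Qed.

Lemma repr_modZ a x : r (a *: r x) = r (a *: x).
Proof.
apply/esym/eq_repr_mod; rewrite -scalerBr; apply: submodZ => //.
exact: repr_modP.
Qed.

Lemma repr_mod_act g x : r (lieact g (r x)) = r (lieact g x).
Proof.
apply/esym/eq_repr_mod; rewrite -lieactB; apply: submod_act => //.
exact: repr_modP.
Qed.

Lemma repr_mod_in x : N x -> N (r x).
Proof.
move=> Nx; rewrite -(subKr x (r x)).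
by apply: submodB => //; exact/PN/repr_modP.
Qed.

(** The hypotheses are arguments of the type because the algebraic operations use them: the
    instances can then be inferred from the type alone. *)
Definition quo (_ : submodule N) (_ : submodule P) (_ : P `<=` N) : Type :=
  {y : M | `[< N y /\ r y = y >]}.

Local Notation Q := (quo hN hP PN).

HB.instance Definition _ := [isSub of Q for @sval M _].
HB.instance Definition _ := [Choice of Q by <:].

Lemma quo_of_subproof x : N x -> `[< N (r x) /\ r (r x) = r x >].
Proof.
by move=> Nx; apply/asboolP; split; [exact: repr_mod_in|exact: repr_modK].
Qed.

Definition quo_of x (Nx : N x) : Q := exist _ (r x) (quo_of_subproof Nx).

Lemma quo_in (a : Q) : N (val a).
Proof. by case: a => a /= /asboolP[]. Qed.

Lemma quo_repr (a : Q) : r (val a) = val a.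
Proof. by case: a => a /= /asboolP[]. Qed.

Let add (a b : Q) := quo_of (submodD hN (quo_in a) (quo_in b)).
Let opp (a : Q) := quo_of (submodN hN (quo_in a)).
Let scale c (a : Q) := quo_of (submodZ c hN (quo_in a)).
Let act g (a : Q) := quo_of (submod_act g hN (quo_in a)).
Let zero := quo_of (submod0 hN).

Fact quo_addA : associative add.
Proof.
by move=> a b c; apply: val_inj; rewrite /= repr_modDl repr_modDr addrA.
Qed.
Fact quo_addC : commutative add.
Proof. by move=> a b; apply: val_inj; rewrite /= addrC. Qed.
Fact quo_add0 : left_id zero add.
Proof. by move=> a; apply: val_inj; rewrite /= repr_modDl add0r quo_repr. Qed.
Fact quo_addN : left_inverse zero opp add.
Proof. by move=> a; apply: val_inj; rewrite /= repr_modDl addNr. Qed.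

HB.instance Definition _ :=
  GRing.isZmodule.Build Q quo_addA quo_addC quo_add0 quo_addN.

Fact quo_scaleA c d (a : Q) : scale c (scale d a) = scale (c * d) a.
Proof. by apply: val_inj; rewrite /= repr_modZ scalerA. Qed.
Fact quo_scale1 : left_id 1 scale.
Proof. by move=> a; apply: val_inj; rewrite /= scale1r quo_repr. Qed.
Fact quo_scaleDr : right_distributive scale +%R.
Proof.
move=> c a b; apply: val_inj.
by rewrite /= repr_modZ repr_modDl repr_modDr scalerDr.
Qed.
Fact quo_scaleDl (a : Q) : {morph scale^~ a : c d / c + d}.
Proof.
move=> c d; apply: val_inj.
by rewrite /= repr_modDl repr_modDr scalerDl.
Qed.

HB.instance Definition _ := GRing.Zmodule_isLmodule.Build K Q
  quo_scaleA quo_scale1 quo_scaleDr quo_scaleDl.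

Lemma val_quoD (a b : Q) : val (a + b) = r (val a + val b).
Proof. by []. Qed.
Lemma val_quoZ c (a : Q) : val (c *: a) = r (c *: val a).
Proof. by []. Qed.
Lemma val_quoB (a b : Q) : val (a - b) = r (val a - val b).
Proof. by rewrite val_quoD /= repr_modDr. Qed.

Fact quo_actl (a : Q) : linear (fun g => act g a).
Proof.
move=> c g h; apply: val_inj; rewrite val_quoD val_quoZ /=.
by rewrite repr_modZ repr_modDl repr_modDr lieact_linearl.
Qed.
Fact quo_actr g : linear (act g).
Proof.
move=> c a b; apply: val_inj; rewrite val_quoD val_quoZ /=.
rewrite repr_modZ repr_modDl repr_modDr repr_mod_act repr_modDl.
by rewrite lieact_linearr.
Qed.
Fact quo_act_lie g h (a : Q) :
  act (lie g h) a = act g (act h a) - act h (act g a).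
Proof.
apply: val_inj; rewrite val_quoB /= !repr_mod_act repr_modDl lieact_lie.
apply/esym/eq_repr_mod; rewrite opprB addrC addrA subrK; exact: repr_modP.
Qed.

HB.instance Definition _ := Lmodule_isLieModule.Build K L Q
  quo_actl quo_actr quo_act_lie.

Definition quo_proj (x : M) : Q :=
  if pselect (N x) is left Nx then quo_of Nx else 0.

Lemma val_quo_proj x : N x -> val (quo_proj x) = r x.
Proof. by rewrite /quo_proj; case: pselect. Qed.

Lemma quo_projK (a : Q) : quo_proj (val a) = a.
Proof.
by apply: val_inj; rewrite val_quo_proj ?quo_repr //; exact: quo_in.
Qed.

Lemma quo_proj_hom : module_hom_on N quo_proj.
Proof.
split=> [a x y Nx Ny|g x Nx]; apply: val_inj.
  have Naxy : N (a *: x + y) by case: hN => _ + _; apply.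
  rewrite val_quoD val_quoZ !val_quo_proj //.
  by rewrite repr_modDl repr_modDr -repr_modDl repr_modZ repr_modDl.
rewrite val_quo_proj; last exact: submod_act.
by rewrite /= val_quo_proj // repr_mod_act.
Qed.

Lemma quo_proj_eq0 x : N x -> quo_proj x = 0 <-> P x.
Proof.
move=> Nx; have r0 : val (0 : Q) = r 0 by [].
split=> [/(congr1 val)|Px].
  rewrite r0 val_quo_proj // => e; have := repr_modP x; rewrite e => Px.
  have := submodB hP Px (repr_modP 0).
  by rewrite sub0r opprK subrK.
by apply: val_inj; rewrite r0 val_quo_proj //; apply: eq_repr_mod;
  rewrite subr0.
Qed.

(** A submodule of the quotient pulls back to [R], which lies between [P] and [N]. *)
Lemma quo_simple : maximal_submodule N P -> simple_module Q.
Proof.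
move=> [_ _ nNP maxP]; split.
  have /existsNP[x /not_implyP[Nx nPx]] := nNP.
  by exists (quo_proj x); apply/eqP => /(quo_proj_eq0 Nx).
have [fD fact] := quo_proj_hom.
move=> S [S0 Sl Sa]; pose R : set M := [set x | N x /\ S (quo_proj x)].
have hR : submodule R.
  split; first by split; [exact: submod0|rewrite (quo_proj_eq0 _).2 //;
    exact: submod0].
    move=> a x y [Nx Sx] [Ny Sy]; split; first by case: hN => _ + _; apply.
    by rewrite fD //; exact: Sl.
  by move=> g x [Nx Sx]; split; [exact: submod_act|rewrite fact //; exact: Sa].
have PR : P `<=` R.
  by move=> x Px; have Nx := PN Px; split=> //; rewrite (quo_proj_eq0 _).2.
have [|h|h] := maxP _ hR PR; first by move=> x [].
  left; apply/seteqP; split=> [a Sa'|_ ->//].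
  rewrite /= -(quo_projK a); apply/quo_proj_eq0; first exact: quo_in.
  by apply: h; split; rewrite ?quo_projK //; exact: quo_in.
right; apply/seteqP; split=> // a _; rewrite -(quo_projK a).
by case: (h _ (quo_in a)).
Qed.

End Quotient.

(** * The radical and the maximal submodules *)

Section Radical.
Variables (K : fieldType) (L : lieAlgType K) (M : lieModType L).
Implicit Types (N P Q : set M) (x y : M).

Lemma rad_sub_maximal N P : submodule N -> maximal_submodule N P ->
  Defs.rad N `<=` P.
Proof.
move=> hN mP x [Nx radx]; have [hP PN _ _] := mP.
apply/(quo_proj_eq0 hN hP PN Nx); apply: radx; first exact: quo_simple.
exact: quo_proj_hom.
Qed.

(** The kernel of a nonzero homomorphism to a simple module is maximal, because the image of any
    larger submodule is everything. *)
Lemma maximal_sub_rad N Z : submodule N -> Z `<=` N ->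
  (forall P, maximal_submodule N P -> Z `<=` P) -> Z `<=` Defs.rad N.
Proof.
move=> hN ZN hZ x Zx; split=> [|S f [S0 simS] [fl fact]]; first exact: ZN.
apply: contrapT => nfx0.
have f0 : f 0 = 0.
  have := fl 1 _ _ (submod0 hN) (submod0 hN); rewrite !scale1r addr0.
  by move/(congr1 (fun z => z - f 0)); rewrite subrr addrK.
have fB y z : N y -> N z -> f (y - z) = f y - f z.
  by move=> Ny Nz; rewrite addrC -scaleN1r fl // scaleN1r addrC.
have fim Q : submodule Q -> Q `<=` N -> submodule [set f y | y in Q].
  move=> hQ QN; split; first by exists 0 => //; exact: submod0.
    move=> a _ _ [y Qy <-] [z Qz <-]; exists (a *: y + z).
      by case: hQ => _ + _; apply.
    by apply: fl; exact: QN.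
  move=> g _ [y Qy <-]; exists (lieact g y); first exact: submod_act.
  by apply: fact; exact: QN.
apply: (nfx0); apply: (hZ [set y | N y /\ f y = 0] _ x Zx).2; split.
- split; first by split=> //; exact: submod0.
    move=> a y z [Ny fy] [Nz fz]; split; first by case: hN => _ + _; apply.
    by rewrite fl // fy fz scaler0 addr0.
  move=> g y [Ny fy]; split; first exact: submod_act.
  by rewrite fact // fy lieact0.
- by move=> y [].
- by move=> /(_ x (ZN _ Zx))[_ /nfx0].
move=> Q hQ kQ QN.
have [e|e] := simS _ (fim _ hQ QN).
  left=> y Qy; split; first exact: QN.
  by have : [set f y | y in Q] (f y) by [exists y]; rewrite e.
right=> y Ny; have [z Qz fz] : [set f y | y in Q] (f y) by rewrite e.
rewrite -(subrK z y); apply: submodD => //; apply: kQ; split.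
  by apply: submodB => //; exact: QN.
by rewrite fB ?fz ?subrr //; exact: QN.
Qed.

Definition largest_proper_submodule N Z :=
  [/\ submodule N, submodule Z, Z `<=` N, ~ (N `<=` Z) &
    forall P, submodule P -> P `<=` N -> ~ (P `<=` Z) -> N `<=` P].

Lemma rad_eq N Z : largest_proper_submodule N Z -> Defs.rad N = Z.
Proof.
move=> [hN hZ ZN nNZ maxZ]; apply/seteqP; split.
  apply: rad_sub_maximal => //; split=> // Q hQ _ QN.
  by have [|nQZ] := pselect (Q `<=` Z); [left|right; exact: maxZ].
apply: maximal_sub_rad => // P [hP PN nNP maxP].
have [PZ|/(maxZ _ hP PN)//] := pselect (P `<=` Z).
by have [|/nNZ] := maxP _ hZ PZ ZN.
Qed.

Lemma rad_subset N N' : N `<=` N' -> Defs.rad N `<=` Defs.rad N'.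
Proof.
move=> NN' x [Nx h]; split=> [|S f simS [fl fact]]; first exact: NN'.
by apply: h simS _; split=> [a y z /NN' Ny /NN' Nz|g y /NN' Ny];
  [exact: fl|exact: fact].
Qed.

(** [N], of codimension one, and the line plus [Z] are maximal submodules that meet in [Z]; the
    reverse inclusion is monotonicity of the radical. *)
Lemma rad_line_add N Z e :
  submodule [set c *: e | c in setT] -> largest_proper_submodule N Z -> ~ N e ->
  Defs.rad [set a + b | a in [set c *: e | c in setT] & b in N] = Z.
Proof.
set C := [set c *: e | c in setT] => hC NZ nNe; have [hN hZ ZN nNZ maxZ] := NZ.
set CN := [set a + b | a in C & b in N].
have hCN : submodule CN by exact: submodule_addset.
have Ce c : C (c *: e) by exists c.
have NCN : N `<=` CN.
  by move=> y Ny; exists 0; [exact: submod0 hC|exists y => //; rewrite add0r].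
have eN c : N (c *: e) -> c = 0.
  move=> h; apply: contrapT => /eqP c0; apply: nNe.
  by have := submodZ c^-1 hN h; rewrite scalerA mulVf // scale1r.
have CNe : CN e.
  by exists (1 *: e) => //; exists 0; [exact: submod0|rewrite scale1r addr0].
have CNsub Q : submodule Q -> Q e -> N `<=` Q -> CN `<=` Q.
  move=> hQ Qe NQ _ [_ [c _ <-] [y Ny <-]]; apply: submodD => //;
    last exact: NQ.
  exact: submodZ.
have radN : Defs.rad N = Z by exact: rad_eq.
apply/seteqP; split; last by rewrite -radN; exact: rad_subset.
set CZ := [set a + b | a in C & b in Z].
have CZCN : CZ `<=` CN by move=> _ [a Ca [z Zz <-]]; exists a => //;
  exists z => //; exact: ZN.
have maxN : maximal_submodule CN N.
  split=> //; first by move=> /(_ _ CNe).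
  move=> Q hQ NQ QCN; have [Qe|nQe] := pselect (Q e); [right|left].
    exact: CNsub.
  move=> q Qq; have [_ [c _ <-] [y Ny yq]] := QCN _ Qq.
  have [c0|c0] := eqVneq c 0; first by rewrite -yq c0 scale0r add0r.
  case: nQe; have := submodZ c^-1 hQ (submodB hQ Qq (NQ _ Ny)).
  by rewrite -yq addrK scalerA mulVf // scale1r.
have maxCZ : maximal_submodule CN CZ.
  split=> //; first exact: submodule_addset.
    move=> h; apply: nNZ => y Ny; have [_ [c _ <-] [z Zz zy]] := h _ (NCN _ Ny).
    have c0 : c = 0.
      by apply: eN; have := submodB hN Ny (ZN _ Zz); rewrite -zy addrK.
    by rewrite -zy c0 scale0r add0r.
  move=> Q hQ CZQ QCN.
  have CQ c : Q (c *: e).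
    by apply: CZQ; exists (c *: e) => //; exists 0;
      [exact: submod0|rewrite addr0].
  (* Since [Q] contains the line, it is the line plus its part in [N], so the position of that part
     relative to [Z] decides. *)
  have [QZ|nQZ] := pselect (Q `&` N `<=` Z); [left|right].
    move=> q Qq; have [_ [c _ <-] [y Ny yq]] := QCN _ Qq.
    exists (c *: e) => //; exists y => //; apply: QZ; split=> //.
    by have := submodB hQ Qq (CQ c); rewrite -yq addrC addKr.
  apply: CNsub => //; first by have := CQ 1; rewrite scale1r.
  have QN : Q `&` N `<=` N by move=> ? [].
  by move=> y /(maxZ _ (submoduleI hQ hN) QN nQZ) [].
move=> y rady; have Ny := rad_sub_maximal hCN maxN rady.
have [_ [c _ <-] [z Zz zy]] := rad_sub_maximal hCN maxCZ rady.
have c0 : c = 0.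
  by apply: eN; have := submodB hN Ny (ZN _ Zz); rewrite -zy addrK.
by rewrite -zy c0 scale0r add0r.
Qed.

End Radical.

(** * Operators with finite rows and columns *)

Lemma sum_supp_eq (B : eqType) (W : nmodType) (F : B -> W) (s s' : seq B) :
  uniq s -> uniq s' -> (forall b, F b != 0 -> b \in s) ->
  (forall b, F b != 0 -> b \in s') -> \sum_(b <- s) F b = \sum_(b <- s') F b.
Proof.
move=> us us' hs hs'.
have h r : \sum_(b <- r) F b = \sum_(b <- [seq b <- r | F b != 0]) F b.
  rewrite big_filter [RHS]big_mkcond; apply: eq_bigr => b _.
  by have [->|] := eqVneq (F b) 0.
rewrite h (h s'); apply: perm_big; apply: uniq_perm; rewrite ?filter_uniq //.
move=> b; rewrite !mem_filter; have [//|Fb] := eqVneq (F b) 0.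
by rewrite hs // hs'.
Qed.

Definition inj_on (J T : Type) (D : set J) (h : J -> T) :=
  forall j j', D j -> D j' -> h j = h j' -> j = j'.

Lemma natb_neq0 (R : nzRingType) (c : bool) : (c%:R != 0 :> R) = c.
Proof. by case: c; rewrite ?oner_eq0 ?eqxx. Qed.

Section Basis.
Variables (K : fieldType) (V : lmodType K) (B : choiceType).
Variables (v : B -> V) (x : B -> {scalar V}).
Hypotheses (v_basis : is_basis v) (x_dual : dual_family v x).

Lemma basis_expand u : exists2 s : seq B, uniq s &
  u = \sum_(b <- s) x b u *: v b /\ forall b, x b u != 0 -> b \in s.
Proof.
have [s [c e]] := v_basis.2 u; exists (undup s); first exact: undup_uniq.
have xu b : x b u = \sum_(a <- s) c a * (a == b)%:R.
  rewrite e linear_sum; apply: eq_bigr => a _.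
  by rewrite linearZ /= x_dual.
split; last first.
  move=> b; apply: contraNT; rewrite mem_undup xu => bs.
  rewrite big_seq big1 // => a a_s; case: eqP => [ab|_]; last by rewrite mulr0.
  by rewrite -ab a_s in bs.
rewrite {1}e; under [RHS]eq_bigr do rewrite xu scaler_suml.
rewrite exchange_big /= big_seq [RHS]big_seq; apply: eq_bigr => a a_s.
rewrite (bigD1_seq a) ?mem_undup ?undup_uniq //= eqxx mulr1 big1 ?addr0 //.
by move=> b /negPf; rewrite eq_sym => ->; rewrite mulr0 scale0r.
Qed.

Lemma finite_supp u : finite_set [set b | x b u != 0].
Proof.
have [s _ [_ hs]] := basis_expand u.
by apply: sub_finite_set (finite_seq s) => b /= /hs.
Qed.

Definition supp (u : V) : seq B :=
  [seq b <- s2val (cid2 (basis_expand u)) | x b u != 0].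

Lemma mem_supp u b : (b \in supp u) = (x b u != 0).
Proof.
rewrite mem_filter; case: cid2 => s /= _ [_ hs].
by have [//|/hs ->] := eqVneq (x b u) 0.
Qed.

Lemma uniq_supp u : uniq (supp u).
Proof. by rewrite filter_uniq //; case: cid2. Qed.

Lemma basis_sum u (s : seq B) : uniq s -> (forall b, x b u != 0 -> b \in s) ->
  u = \sum_(b <- s) x b u *: v b.
Proof.
move=> us hs; have [s' us' [e hs']] := basis_expand u.
rewrite {1}e; apply: sum_supp_eq => // b;
  rewrite scaler_eq0 negb_or => /andP[xb _].
  exact: hs'.
exact: hs.
Qed.

Lemma coord_eq0 u : (forall b, x b u = 0) -> u = 0.
Proof. by move=> h; rewrite (@basis_sum u [::]) ?big_nil // => b;
  rewrite h eqxx. Qed.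

Lemma coord_inj u w : (forall b, x b u = x b w) -> u = w.
Proof.
move=> h; apply/eqP; rewrite -subr_eq0; apply/eqP/coord_eq0 => b.
by rewrite linearB /= h subrr.
Qed.

Lemma coord_neq0 u : u != 0 -> exists b, x b u != 0.
Proof.
move=> u0; apply: contrapT => /forallNP h; move/eqP: u0; apply.
by apply: coord_eq0 => b; apply: contrapT => /eqP /h.
Qed.

Section Extension.
Variables (W : lmodType K) (f : B -> W).

Definition basis_ext (u : V) : W := \sum_(b <- supp u) x b u *: f b.

Lemma basis_extE u (s : seq B) : uniq s -> (forall b, x b u != 0 -> b \in s) ->
  basis_ext u = \sum_(b <- s) x b u *: f b.
Proof.
move=> us hs; apply: sum_supp_eq; rewrite ?uniq_supp // => b;
  rewrite scaler_eq0 negb_or => /andP[xb _]; first by rewrite mem_supp.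
exact: hs.
Qed.

Lemma basis_ext_linear : linear basis_ext.
Proof.
move=> c u w; pose s := undup (supp u ++ supp w ++ supp (c *: u + w)).
have sE b : (b \in s) =
    [|| x b u != 0, x b w != 0 | x b (c *: u + w) != 0].
  by rewrite mem_undup !mem_cat !mem_supp.
have us : uniq s by exact: undup_uniq.
rewrite (basis_extE us) ?(@basis_extE u s) ?(@basis_extE w s) //;
  try by move=> b h; rewrite sE h ?orbT.
rewrite scaler_sumr -big_split; apply: eq_bigr => b _ /=.
by rewrite linearP scalerDl scalerA.
Qed.

Lemma basis_ext_basis b : basis_ext (v b) = f b.
Proof.
rewrite (@basis_extE _ [:: b]) //.
  by rewrite big_seq1 x_dual eqxx scale1r.
by move=> a; rewrite x_dual natb_neq0 inE eq_sym.
Qed.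
End Extension.

Lemma linear_basis_eq (W : lmodType K) (f g : V -> W) : linear f -> linear g ->
  (forall b, f (v b) = g (v b)) -> f =1 g.
Proof.
move=> lf lg e u; pose f' := GRing.isLinear.Build _ _ _ _ f lf.
pose g' := GRing.isLinear.Build _ _ _ _ g lg.
pose F : {linear V -> W} := HB.pack f f';
  pose G : {linear V -> W} := HB.pack g g'.
have [s _ [-> _]] := basis_expand u.
rewrite -[f]/(F : V -> W) -[g]/(G : V -> W) !linear_sum; apply: eq_bigr => b _.
by rewrite !linearZ /= e.
Qed.

Lemma scalar_sum (y : {scalar V}) u (s : seq B) : uniq s ->
  (forall b, x b u != 0 -> b \in s) -> y u = \sum_(b <- s) x b u * y (v b).
Proof.
move=> us hs; rewrite {1}(basis_sum us hs) linear_sum.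
by apply: eq_bigr => b _; rewrite linearZ.
Qed.

Lemma scalar_ext (g : B -> K) :
  exists y : {scalar V}, forall a, y (v a) = g a.
Proof.
have lin : scalar (@basis_ext K^o g : V -> K).
  by move=> c u w; exact: (@basis_ext_linear K^o g c u w).
pose y := GRing.isLinear.Build K V K *%R (@basis_ext K^o g) lin.
exists (HB.pack_for {scalar V} (@basis_ext K^o g : V -> K) y) => a.
exact: (@basis_ext_basis K^o g a).
Qed.

Lemma VlowP (y : {scalar V}) : Vlow x y <-> finite_set [set b | y (v b) != 0].
Proof.
split=> [[s e]|].
  apply: sub_finite_set (finite_seq [seq p.2 | p <- s]) => b /=.
  apply: contraNT => bs; rewrite e big_seq big1 // => p ps.
  rewrite x_dual; case: eqP => [bp|_]; last by rewrite mulr0.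
  by move: bs; rewrite bp map_f.
move=> /[dup] fY /finite_seqP[s0 e0]; pose s := undup s0.
have hs b : y (v b) != 0 -> b \in s.
  by rewrite mem_undup => h; have : [set b | y (v b) != 0] b by []; rewrite e0.
exists [seq (y (v b), b) | b <- s] => u; rewrite big_map /=.
have [r ur [_ hr]] := basis_expand u.
rewrite (scalar_sum y ur hr) (eq_bigr (fun b => y (v b) * x b u)); last first.
  by move=> b _; rewrite mulrC.
apply: sum_supp_eq; rewrite ?undup_uniq // => b;
  rewrite mulf_eq0 negb_or => /andP[h1 h2]; first exact: hr.
exact: hs.
Qed.

Lemma Vlow_dual a : Vlow x (x a).
Proof.
apply/VlowP; apply: sub_finite_set (finite_set1 a) => b /=.
by rewrite x_dual natb_neq0 => /eqP.
Qed.

Lemma glM_row_finite (phi : glM x) a :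
  finite_set [set b | x a (phi (v b)) != 0].
Proof. by have /VlowP := glM_dual phi (Vlow_dual a). Qed.

Definition row_finite (f : B -> V) :=
  forall a, finite_set [set b | x a (f b) != 0].

(** A functional in V_* involves finitely many rows, and each of them meets finitely many columns,
    so its pullback has finite support again. Operators can thus be built column by column. *)
Lemma mackey_basis_ext f : row_finite f -> basis_ext f \in mackey x.
Proof.
move=> ff; apply/mackeyP; split; first exact: basis_ext_linear.
move=> y y' /VlowP fy e; apply/VlowP.
apply: sub_finite_set (bigcup_finite fy (fun a _ => ff a)) => b /=.
rewrite e basis_ext_basis => yb.
apply: contrapT => nb; move/eqP: yb; apply.
rewrite (scalar_sum y (uniq_supp (f b))); last by move=> a; rewrite mem_supp.
rewrite big1 // => a _; apply/eqP; rewrite mulf_eq0.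
have [|h1] := eqVneq (x a (f b)) 0; rewrite //=.
have [//|h2] := eqVneq (y (v a)) 0.
by case: nb; exists a.
Qed.

Definition glM_mk f (ff : row_finite f) : glM x := GlM (mackey_basis_ext ff).

Lemma glM_mkE f (ff : row_finite f) b : glM_mk ff (v b) = f b.
Proof. exact: basis_ext_basis. Qed.

Lemma glM_eq (phi psi : glM x) :
  (forall b, phi (v b) = psi (v b)) -> phi = psi.
Proof. by move=> e; apply: glM_ext; apply: linear_basis_eq => //;
  exact: glM_linear. Qed.

Definition cols (phi : glM x) : set B := [set b | phi (v b) != 0].

(** Turns a condition on all functionals into a count of columns. A family [E] of columns with
    disjoint supports is detected by one functional, the indicator of one support point [rho b] for
    each [b] in [E]. If [E] is maximal, every nonzero column meets the support of a member, and by
    finiteness of rows only finitely many meet a given one. *)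
Lemma glM_idealP s (phi : glM x) : glM_ideal v s phi <-> lt_aleph s (cols phi).
Proof.
split=> [h|h y]; last first.
  apply: lt_aleph_sub h => b /=; apply: contraNN => /eqP e.
  by rewrite /= e linear0.
pose F b : set B := [set a | x a (phi (v b)) != 0].
have [E [ED tE maxE]] := maximal_disjoint F (cols phi).
have /choice[rho rhoP] : forall b, exists a, E b -> F b a.
  move=> b; have [/ED/coord_neq0[a ha]|nE] := pselect (E b); first by exists a.
  by exists b.
have [y yv] := scalar_ext
  (fun a => (`[< exists2 b, E b & rho b = a >])%:R).
have ltE : lt_aleph s E.
  apply: lt_aleph_sub (h y) => b Eb; change (y (phi (v b)) != 0).
  rewrite (scalar_sum y (uniq_supp (phi (v b)))); last first.
    by move=> a; rewrite mem_supp.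
  have rb : x (rho b) (phi (v b)) != 0 := rhoP b Eb.
  rewrite (bigD1_seq (rho b)) ?uniq_supp ?mem_supp //.
  rewrite yv asboolT; last by exists b.
  rewrite mulr1 /= big1_seq ?addr0 //.
  move=> a /andP[nab ab]; rewrite yv; case: asboolP => [[b' Eb' e]|_];
    last first.
    by rewrite mulr0.
  have bb' : b = b'.
    apply: tE => //; exists a; split; first by rewrite /F /= -mem_supp.
    by rewrite -e; exact: rhoP.
  by rewrite -e bb' eqxx in nab.
have fN b : E b ->
    finite_set (\bigcup_(a in F b) [set b' | x a (phi (v b')) != 0]).
  move=> Eb; apply: bigcup_finite => [|a _]; last exact: glM_row_finite.
  exact: finite_supp.
apply: lt_aleph_sub (lt_aleph_bigcup ltE fN) => b Db.
have [b' Eb' [e|[a [ab ab']]]] := maxE _ Db; last by exists b' => //; exists a.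
by have [a ab] := coord_neq0 Db; exists b; [rewrite -e|exists a].
Qed.

Implicit Types (phi psi : glM x) (I : set (glM x)).

Local Notation gl := (adjoint (glM x) : lieModType (glM x)).

Lemma coord_linear phi a u :
  x a (phi u) = \sum_(b <- supp u) x b u * x a (phi (v b)).
Proof.
have hs b : x b u != 0 -> b \in supp u by rewrite mem_supp.
exact: (scalar_sum (dual_end phi (x a)) (uniq_supp u) hs).
Qed.

Lemma coord_eq0_on phi a :
  (forall b, x a (phi (v b)) = 0) -> forall u, x a (phi u) = 0.
Proof. by move=> h u; rewrite coord_linear big1 // => b _; rewrite h mulr0. Qed.

Lemma glM_linB phi u w : phi (u - w) = phi u - phi w.
Proof. exact: linearB. Qed.

Lemma glM_linD phi u w : phi (u + w) = phi u + phi w.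
Proof. exact: linearD. Qed.

Lemma glM_linZ phi a u : phi (a *: u) = a *: phi u.
Proof. exact: linearZ. Qed.

Lemma glM_lin0 phi : phi 0 = 0.
Proof. exact: linear0. Qed.

Fact mackey_comp phi psi : (phi \o psi : V -> V) \in mackey x.
Proof.
apply/mackeyP; split=> [a u w|y y' hy e]; first by rewrite /= !glM_linear.
have h := glM_dual psi (glM_dual phi hy).
by apply: (Vlow_comb (a := 1) (b := 0) h h) => u; rewrite e mul1r mul0r addr0.
Qed.

Definition glM_comp phi psi : glM x := GlM (mackey_comp phi psi).

Lemma glM_compE phi psi u : glM_comp phi psi u = phi (psi u). Proof. by []. Qed.

Lemma lieE phi psi u : (lie phi psi : glM x) u = phi (psi u) - psi (phi u).
Proof. by []. Qed.

Lemma glM_subE phi psi u : (phi - psi) u = phi u - psi u.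
Proof. by []. Qed.

Lemma glM_idE u : glM_id x u = u. Proof. by []. Qed.

Fact diag_subproof (d : B -> K) : row_finite (fun b => d b *: v b).
Proof.
move=> a; apply: sub_finite_set (finite_set1 a) => b /=.
rewrite linearZ /= x_dual; have [//|] := eqVneq b a.
by rewrite mulr0 eqxx.
Qed.

Definition diag (d : B -> K) : glM x := glM_mk (@diag_subproof d).

Lemma diagE d b : diag d (v b) = d b *: v b.
Proof. exact: glM_mkE. Qed.

Lemma diag_coord d a u : x a (diag d u) = d a * x a u.
Proof.
rewrite coord_linear; have hs b : x b u != 0 -> b \in supp u
  by rewrite mem_supp.
rewrite (scalar_sum (x a) (uniq_supp u) hs) mulr_sumr; apply: eq_bigr => b _.
rewrite diagE linearZ /= x_dual; have [->|_] := eqVneq b a.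
  by rewrite mulrCA.
by rewrite !mulr0.
Qed.

Lemma diag_eq0 d u : (forall b, x b u != 0 -> d b = 0) -> diag d u = 0.
Proof.
move=> h; apply: coord_eq0 => a; rewrite diag_coord.
by have [->|/h ->] := eqVneq (x a u) 0; rewrite ?mulr0 ?mul0r.
Qed.

Definition indic (A : set B) (b : B) : K := (`[< A b >])%:R.

Lemma indicT (A : set B) b : A b -> indic A b = 1.
Proof. by move=> h; rewrite /indic asboolT. Qed.

Lemma indicF (A : set B) b : ~ A b -> indic A b = 0.
Proof. by move=> h; rewrite /indic asboolF. Qed.

Lemma indic_neq0 (A : set B) b : indic A b != 0 -> A b.
Proof. by rewrite /indic natb_neq0 => /asboolP. Qed.

(* [munit D c f g] is the sum over [j] in [D] of the [c j] times the matrix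
   unit sending [v (g j)] to [v (f j)]; it is meaningful when [f] and [g] are
   injective on [D]. *)
Section MatrixUnits.
Variables (J : Type) (D : set J) (c : J -> K) (f g : J -> B).

Definition munit_fun (b : B) : V :=
  if pselect (exists2 j, D j & g j = b) is left h
  then c (s2val (cid2 h)) *: v (f (s2val (cid2 h))) else 0.

Definition munit : glM x :=
  if pselect (row_finite munit_fun) is left h then glM_mk h else 0.

Hypotheses (finj : inj_on D f) (ginj : inj_on D g).

Lemma munit_funE j : D j -> munit_fun (g j) = c j *: v (f j).
Proof.
rewrite /munit_fun => Dj; case: pselect => [h|[]]; last by exists j.
by case: cid2 => j' /= Dj' e; rewrite (ginj Dj' Dj e).
Qed.

Lemma munit_fun0 b : (forall j, D j -> g j <> b) -> munit_fun b = 0.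
Proof.
by rewrite /munit_fun => h; case: pselect => // -[j Dj e]; case: (h j).
Qed.

Lemma munit_row_finite : row_finite munit_fun.
Proof.
move=> a; have [[j Dj fj]|na] := pselect (exists2 j, D j & f j = a); last first.
  suff -> : [set b | x a (munit_fun b) != 0] = set0 by exact: finite_set0.
  apply/seteqP; split=> b //=;
    have [[j Dj <-]|nb] := pselect (exists2 j, D j & g j = b).
    rewrite munit_funE // linearZ /= x_dual; have [e|] := eqVneq (f j) a.
      by case: na; exists j.
    by rewrite mulr0 eqxx.
  by rewrite munit_fun0 ?linear0 ?eqxx // => j Dj e; apply: nb; exists j.
apply: sub_finite_set (finite_set1 (g j)) => b /=.
have [[j' Dj' <-]|nb] := pselect (exists2 j, D j & g j = b); last first.
  by rewrite munit_fun0 ?linear0 ?eqxx // => j' Dj' e; apply: nb; exists j'.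
rewrite munit_funE // linearZ /= x_dual; have [e|] := eqVneq (f j') a.
  by rewrite -fj in e; rewrite (finj Dj' Dj e).
by rewrite mulr0 eqxx.
Qed.

Lemma munitE j : D j -> munit (v (g j)) = c j *: v (f j).
Proof.
move=> Dj; rewrite /munit; case: pselect => [h|[]];
  last exact: munit_row_finite.
by rewrite glM_mkE munit_funE.
Qed.

Lemma munit0 b : (forall j, D j -> g j <> b) -> munit (v b) = 0.
Proof.
move=> h; rewrite /munit; case: pselect => [k|//].
by rewrite glM_mkE munit_fun0.
Qed.

Lemma munit_row j u : D j -> x (f j) (munit u) = c j * x (g j) u.
Proof.
move=> Dj; rewrite coord_linear.
have hs b : x b u != 0 -> b \in supp u by rewrite mem_supp.
rewrite (scalar_sum (x (g j)) (uniq_supp u) hs) mulr_sumr;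
  apply: eq_bigr => b _.
rewrite mulrCA; congr (_ * _); rewrite x_dual.
have [[j' Dj' <-]|nb] := pselect (exists2 j, D j & g j = b); last first.
  rewrite munit0 => [|j' Dj' e]; last by apply: nb; exists j'.
  rewrite linear0; have [e|] := eqVneq b (g j); last by rewrite mulr0.
  by case: nb; exists j.
rewrite munitE // linearZ /= x_dual.
have [e|ne] := eqVneq (f j') (f j); have [e'|ne'] := eqVneq (g j') (g j);
  rewrite ?mulr0 //.
- by rewrite (finj Dj' Dj e).
- by rewrite (finj Dj' Dj e) eqxx in ne'.
- by rewrite (ginj Dj' Dj e') eqxx in ne.
Qed.

Lemma munit_row0 a u : (forall j, D j -> f j <> a) -> x a (munit u) = 0.
Proof.
move=> h; apply: coord_eq0_on => b.
have [[j Dj <-]|nb] := pselect (exists2 j, D j & g j = b); last first.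
  by rewrite munit0 ?linear0 // => j Dj e; apply: nb; exists j.
rewrite munitE // linearZ /= x_dual; have [e|] := eqVneq (f j) a.
  by case: (h j).
by rewrite mulr0.
Qed.

Lemma munit_ker u : (forall j, D j -> x (g j) u = 0) -> munit u = 0.
Proof.
move=> h; apply: coord_eq0 => a.
have [[j Dj <-]|nb] := pselect (exists2 j, D j & f j = a); last first.
  by rewrite munit_row0 // => j Dj e; apply: nb; exists j.
by rewrite munit_row // h // mulr0.
Qed.

End MatrixUnits.

Section Ideals.
Variable I : set (glM x).
Hypothesis hI : submodule (I : set gl).

Lemma idealD phi psi : I phi -> I psi -> I (phi + psi).
Proof. by move=> h k; have := submodD hI h k. Qed.

Lemma idealZ a phi : I phi -> I (a *: phi).
Proof. by move=> h; have := submodZ a hI h. Qed.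

Lemma ideal0 : I 0. Proof. exact: submod0 hI. Qed.

Lemma ideal_liel phi psi : I psi -> I (lie phi psi).
Proof. by move=> h; have := submod_act phi hI h. Qed.

Lemma ideal_lier phi psi : I phi -> I (lie phi psi).
Proof. by move=> h; rewrite lieC -scaleN1r; apply/idealZ/ideal_liel. Qed.

Lemma ideal_sum (J : Type) (s : seq J) (F : J -> glM x) :
  (forall j, I (F j)) -> I (\sum_(j <- s) F j).
Proof.
move=> h; elim: s => [|j s IH]; first by rewrite big_nil; exact: ideal0.
by rewrite big_cons; exact: idealD.
Qed.

(** Z = [A, [phi, Q]] equals A phi Q + Q phi A, while [A, Z] equals A phi Q - Q phi A; their sum is
    twice the wanted corner. *)
Lemma corner_ideal phi psi (A Q : glM x) : (2%:R : K) != 0 -> I phi ->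
  (forall u, A (A u) = A u) -> (forall u, A (Q u) = 0) ->
  (forall u, Q (A u) = 0) -> (forall b, psi (v b) = A (phi (Q (v b)))) -> I psi.
Proof.
move=> h2 Iphi AA AQ QA e.
pose Z : glM x := lie A (lie phi Q : glM x).
have IZ : I Z by apply/ideal_liel/ideal_lier.
have -> : psi = 2%:R^-1 *: (Z + lie A Z); last first.
  by apply: idealZ; apply: idealD => //; exact: ideal_liel.
have ZE u : Z u = A (phi (Q u)) + Q (phi (A u)).
  by rewrite !lieE glM_linB AQ subr0 QA glM_lin0 sub0r opprK.
apply: glM_eq => b; rewrite glM_scaleE glM_addE (lieE A Z) !ZE e.
rewrite glM_linD !AA AQ addr0 QA !glM_lin0 add0r.
rewrite addrACA subrr addr0 -mulr2n -scaler_nat scalerA mulVf // scale1r.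
by [].
Qed.

(** * Ideals of the Mackey Lie algebra *)

(** The commutator with a diagonal operator multiplies the unit from [g j] to [f j] by the
    difference of the diagonal values at [f j] and [g j], here [e j] and 0. *)
Lemma munit_scale (J : Type) (D : set J) (c e : J -> K) (f g : J -> B) :
  inj_on D f -> inj_on D g -> (forall j j', D j -> D j' -> f j <> g j') ->
  I (munit D c f g) -> I (munit D (fun j => e j * c j) f g).
Proof.
move=> finj ginj fg IM.
have /choice[w wP] : forall b, exists k : K,
    (forall j, D j -> f j = b -> k = e j) /\ (forall j, D j -> g j = b -> k =
      0).
  move=> b; have [[j Dj fj]|nb] := pselect (exists2 j, D j & f j = b).
    exists (e j); split=> j' Dj' e'; first by rewrite (finj j j') // fj e'.
    by case: (fg j j') => //; rewrite fj e'.
  by exists 0; split=> // j Dj fj; case: nb; exists j.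
have -> : munit D (fun j => e j * c j) f g = lie (diag w) (munit D c f g).
  apply: glM_eq => b; rewrite lieE diagE glM_linZ.
  have [[j Dj <-]|nb] := pselect (exists2 j, D j & g j = b); last first.
    have nb' j : D j -> g j <> b by move=> Dj e'; apply: nb; exists j.
    by rewrite !munit0 // glM_lin0 scaler0 subr0.
  rewrite !munitE // glM_linZ !diagE ((wP (g j)).2 j) //.
  by rewrite scale0r subr0 scalerA ((wP (f j)).1 j) // mulrC.
exact: ideal_liel.
Qed.

Definition good_pair phi (p : B * B) :=
  p.1 <> p.2 /\
  (x p.1 (phi (v p.2)) <> 0 \/ x p.1 (phi (v p.1)) <> x p.2 (phi (v p.2))).

(* The family is made sparse so that compressing [phi] to it leaves only one
   matrix entry per pair. *)
Definition sparse_pairs phi (E : set (B * B)) :=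
  [/\ forall p, E p -> good_pair phi p,
      forall p q a, E p -> E q -> (a = p.1 \/ a = p.2) -> (a = q.1 \/ a = q.2)
        ->
        p = q
    & forall p q a b, E p -> E q -> (a = p.1 \/ a = p.2) -> (b = q.1 \/ b =
      q.2) ->
        x a (phi (v b)) <> 0 -> p = q].

Section Sparse.
Variables (phi : glM x) (E : set (B * B)).
Hypothesis hE : sparse_pairs phi E.

Lemma sparse_fst : inj_on E fst.
Proof. by case: hE => _ h _ p q Ep Eq e; apply: (h p q p.1) => //;
  [left|left]. Qed.

Lemma sparse_snd : inj_on E snd.
Proof. by case: hE => _ h _ p q Ep Eq e; apply: (h p q p.2) => //;
  [right|right]. Qed.

Lemma sparse_disjoint p q : E p -> E q -> p.1 <> q.2.
Proof.
case: hE => hg h _ Ep Eq e; have pq : p = q by apply: (h p q p.1) => //;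
  [left|right].
by case: (hg _ Ep) => + _; apply; rewrite e pq.
Qed.

(** Compressing [phi] yields its entries at [(p.1, p.2)]; compressing the commutator of [phi] with
    [T] yields differences of diagonal entries. On a good pair one of the two is nonzero. [T] is the
    operator sought, but it acts here only as a multiplier of [phi], so the argument is not
    circular. *)
Lemma sparse_munit : (2%:R : K) != 0 -> I phi -> I (munit E (fun=> 1) fst snd).
Proof.
move=> h2 Iphi; have [hg _ hs] := hE.
have finj := sparse_fst; have sinj := sparse_snd; have fs := sparse_disjoint.
pose A1 := [set p.1 | p in E]; pose A2 := [set p.2 | p in E].
have ind p : E p -> [/\ indic A1 p.1 = 1, indic A2 p.2 = 1, indic A1 p.2 = 0
    & indic A2 p.1 = 0].
  move=> Ep; split; [apply: indicT; by exists p|apply: indicT; by exists p| |].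
    by apply: indicF => -[q Eq /(fs _ _ Eq Ep)].
  by apply: indicF => -[q Eq /esym /(fs _ _ Ep Eq)].
pose A := diag (indic A1); pose Q := diag (indic A2).
have A12 b : indic A1 b * indic A2 b = 0.
  have [[p Ep <-]|n1] := pselect (A1 b); last by rewrite indicF // mul0r.
  by case: (ind _ Ep) => _ _ _ ->; rewrite mulr0.
have AA u : A (A u) = A u.
  apply: coord_inj => a; rewrite !diag_coord; have [h|h] := pselect (A1 a).
    by rewrite indicT // !mul1r.
  by rewrite indicF // !mul0r.
have AQ u : A (Q u) = 0.
  by apply: coord_eq0 => a; rewrite !diag_coord mulrA A12 mul0r.
have QA u : Q (A u) = 0.
  by apply: coord_eq0 => a; rewrite !diag_coord mulrCA mulrA A12 mul0r.
have corner chi : I chi ->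
    (forall p q, E p -> E q -> x p.1 (chi (v q.2)) <> 0 -> p = q) ->
    I (munit E (fun p => x p.1 (chi (v p.2))) fst snd).
  move=> Ichi hchi; apply: (corner_ideal h2 Ichi AA AQ QA) => b.
  rewrite diagE glM_linZ glM_linZ.
  have [[q Eq <-]|nb] := pselect (A2 b); last first.
    rewrite munit0; first by rewrite indicF // scale0r.
    by move=> q Eq e; apply: nb; exists q.
  rewrite munitE //; case: (ind _ Eq) => _ -> _ _; rewrite scale1r.
  apply: coord_inj => a; rewrite diag_coord linearZ /= x_dual.
  have [[p Ep <-]|na] := pselect (A1 a); last first.
    rewrite (indicF na) mul0r; have [e|] := eqVneq q.1 a; last by rewrite mulr0.
    by case: na; exists q.
  case: (ind _ Ep) => -> _ _ _; rewrite mul1r.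
  have [e|ne] := eqVneq q.1 p.1; first by rewrite (finj q p) // mulr1.
  rewrite mulr0; apply/esym/eqP;
    apply: contraNT ne => /eqP /(hchi _ _ Ep Eq) ->.
  by [].
pose T := munit E (fun=> 1) fst snd.
pose chi : glM x := lie phi T.
have chiE p q : E p -> E q -> x p.1 (chi (v q.2)) =
    x p.1 (phi (v q.1)) - x p.2 (phi (v q.2)).
  move=> Ep Eq; rewrite lieE linearB /= munitE // scale1r.
  by rewrite munit_row // mul1r.
have I1 := corner _ Iphi.
have {}I1 := I1 (fun p q Ep Eq =>
  hs p q _ _ Ep Eq (or_introl erefl) (or_intror erefl)).
have Ichi : I chi by exact: ideal_lier.
have {corner}I2 : I (munit E (fun p => x p.1 (chi (v p.2))) fst snd).
  apply: corner => // p q Ep Eq; rewrite chiE //.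
  have [//|ne] := pselect (p = q).
  have -> : x p.1 (phi (v q.1)) = 0.
    by apply: contrapT => h; apply: ne; apply: hs h => //; left.
  have -> : x p.2 (phi (v q.2)) = 0.
    by apply: contrapT => h; apply: ne; apply: hs h => //; right.
  by rewrite subrr.
pose c1 p := x p.1 (phi (v p.2)); pose c2 p := x p.1 (chi (v p.2)).
(* Pairs with [c1 p = 0] drop out of the first sum, and [e2] normalizes exactly those. *)
pose e1 p : K := (c1 p)^-1; pose e2 p : K := if c1 p == 0 then (c2 p)^-1 else 0.
have -> : munit E (fun=> 1) fst snd =
    munit E (fun p => e1 p * c1 p) fst snd + munit E (fun p =>
      e2 p * c2 p) fst snd.
  apply: glM_eq => b; rewrite glM_addE.
  have [[p Ep <-]|nb] := pselect (exists2 p, E p & p.2 = b); last first.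
    have nb' p : E p -> p.2 <> b by move=> Ep e; apply: nb; exists p.
    by rewrite !munit0 // addr0.
  rewrite !munitE // -scalerDl; congr (_ *: _); rewrite /e1 /e2.
  have [c10|c10] := eqVneq (c1 p) 0; last by rewrite mulVf // mul0r addr0.
  rewrite c10 mulr0 add0r mulVf // /c2 chiE // subr_eq0.
  by case: (hg _ Ep) => _ [/(_ c10)//|/eqP].
by apply: idealD; apply: munit_scale.
Qed.

End Sparse.

(** Disjointness of [F p] and [F q] encodes sparseness: a shared index [a] would make [(a, a)] a
    common element, a nonzero entry linking the pairs would make its position [(a, b)] one. For a
    maximal family [phi] is scalar off the set [S] of all indices involved, so a nonzero column of
    [phi - c *: glM_id x] lies in [S] or meets a row in [S]. *)
Lemma ex_sparse_pairs phi : exists2 E, sparse_pairs phi E &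
  forall s, lt_aleph s E -> exists c, lt_aleph s (cols (phi - c *: glM_id x)).
Proof.
pose F (p : B * B) : set (B * B) := [set q |
  [\/ q.1 = p.1, q.1 = p.2, q.2 = p.1 | q.2 = p.2] /\
  (q.1 = q.2 \/ x q.1 (phi (v q.2)) <> 0)].
have finF p : finite_set (F p).
  pose H a := [set (a, a)] `|` [set (a, b) | b in [set b | x a (phi (v b)) !=
    0]]
    `|` [set (b, a) | b in [set b | x b (phi (v a)) != 0]].
  have finH a : finite_set (H a).
    rewrite !finite_setU; split; first split; first exact: finite_set1.
      by apply: finite_image; exact: glM_row_finite.
    by apply: finite_image; exact: finite_supp.
  apply: (@sub_finite_set _ _ (H p.1 `|` H p.2)); last by rewrite finite_setU.
  move=> [a b] /= [].
  have hab : a = b \/ x a (phi (v b)) <> 0 -> H a (a, b) /\ H b (a, b).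
    move=> [->|/eqP h]; first by split; left; left.
    by split; [left; right; exists b|right; exists a].
  by move=> + /hab[Ha Hb] => -[] e; [left|right|left|right]; rewrite -e.
have [E [EG tE maxE]] := maximal_disjoint F (good_pair phi).
exists E.
  split=> // [p q a Ep Eq ap aq|p q a b Ep Eq ap bq h].
    apply: (tE p q) => //; exists (a, a); split; split=> /=; try by left.
      by case: ap => ->; [constructor 1|constructor 2].
    by case: aq => ->; [constructor 1|constructor 2].
  apply: (tE p q) => //; exists (a, b); split; split=> /=; try by right.
    by case: ap => ->; [constructor 1|constructor 2].
  by case: bq => ->; [constructor 3|constructor 4].
move=> s ltE; pose G q := [set d.1 | d in F q] `|` [set d.2 | d in F q].
have ltG : lt_aleph s (\bigcup_(q in E) G q).
  by apply: lt_aleph_bigcup => // q _; rewrite finite_setU; split;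
    exact: finite_image.
set S := \bigcup_(q in E) G q in ltG.
have SF p q b : E q -> F p b -> F q b -> S p.1 \/ S p.2.
  move=> Eq [hp _] Fqb; case: hp => <-; [left|right|left|right]; exists q => //;
  by [left; exists b|right; exists b].
have nS a b : a <> b -> ~ S a -> ~ S b -> ~ good_pair phi (a, b).
  move=> ab Sa Sb gab; have [q Eq [e|[d [Fd Fqd]]]] := maxE _ gab; last first.
    by case: (SF (a, b) q d).
  rewrite e in Eq; case: (SF (a, b) (a, b) (a, a)) => //; split; try by left.
    by constructor 1.
  by constructor 1.
have ltS' : lt_aleph s (\bigcup_(a in S) ([set a] `|` [set b | x a (phi (v b))
  != 0])).
  apply: lt_aleph_bigcup => // a _; rewrite finite_setU.
  by split; [exact: finite_set1|exact: glM_row_finite].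
(* The diagonal entries outside [S] all agree; [c] is their common value, or 0 if [S] is
   everything. *)
pose c := if pselect (exists b, ~ S b) is left h
  then x (sval (cid h)) (phi (v (sval (cid h)))) else 0.
exists c; apply: lt_aleph_sub ltS' => b Db.
have {Db}[a] := coord_neq0 (Db : (phi - c *: glM_id x) (v b) != 0).
have [Sb|nSb] := pselect (S b); first by move=> _; exists b => //; left.
rewrite glM_subE glM_scaleE glM_idE linearB linearZ /= x_dual.
have [e|ne] := eqVneq b a.
  rewrite -e mulr1 subr_eq0 /c; case: pselect => [h|[]]; last by exists b.
  case: cid => b0 /= nSb0 hb; case: (nS b b0) => //.
    by move=> e'; rewrite e' eqxx in hb.
  by split; [move=> /= e'; rewrite e' eqxx in hb|right; exact/eqP].
rewrite mulr0 subr0 => hab; have [Sa|nSa] := pselect (S a).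
  by exists a => //; right.
case: (nS a b) => //; first by move=> e; rewrite e eqxx in ne.
split; first by move=> /= e; rewrite e eqxx in ne.
by left; exact/eqP.
Qed.

(** Three commutators: [T0] = [T, d] selects the units to be used, [TW] = [T0, W] moves their
    sources to [Q], and [psi] = [psi Phi, TW], where [Phi] carries [f q] back to [q]. The other
    product vanishes each time: first and second components are disjoint, first components avoid
    [Q], and [psi] has no rows in [Q]. *)
Lemma ideal_of_pairs_avoiding (E : set (B * B)) (Q : set B) (i :
  B -> B * B) psi :
  inj_on E fst -> inj_on E snd -> (forall p q, E p -> E q -> p.1 <> q.2) ->
  I (munit E (fun=> 1) fst snd) ->
  (forall b, Q b -> E (i b)) -> inj_on Q i ->
  (forall b q, Q b -> Q q -> b <> (i q).1) ->
  cols psi `<=` Q -> (forall b b', Q b -> x b (psi (v b')) = 0) -> I psi.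
Proof.
move=> finj sinj fs IT iE iinj Qi cQ hQ.
pose f b := (i b).1; pose g b := (i b).2.
have fi : inj_on Q f.
  by move=> b b' Qb Qb' e; apply: iinj => //; apply: finj => //; exact: iE.
have gi : inj_on Q g.
  by move=> b b' Qb Qb' e; apply: iinj => //; apply: sinj => //; exact: iE.
have idi : inj_on Q id by [].
pose W := munit Q (fun=> 1) g id; pose Phi := munit Q (fun=> 1) id f.
pose T := munit E (fun=> 1) fst snd.
have WT u : (forall b, Q b -> x b u = 0) -> W u = 0 by exact: munit_ker.
pose T0 := munit Q (fun=> 1) f g.
have IT0 : I T0.
  pose d := diag (indic [set g b | b in Q]).
  have -> : T0 = lie T d; last exact: ideal_lier.
  apply: glM_eq => b; rewrite lieE diagE.
  have -> : d (T (v b)) = 0.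
    apply: diag_eq0 => a xa; apply: indicF => -[q Qq e]; move: xa.
    rewrite munit_row0 ?eqxx // => p Ep pa; case: (fs p (i q) Ep (iE _ Qq)).
    by rewrite pa -e.
  rewrite subr0 glM_linZ; have [[q Qq <-]|nb] := pselect (exists2 q, Q q & g q
    = b).
    rewrite indicT; last by exists q.
    rewrite /T0 munitE // /T [g q]/(i q).2 munitE //; last exact: iE.
    by rewrite !scale1r.
  rewrite indicF; last by case=> q Qq e; apply: nb; exists q.
  by rewrite scale0r munit0 // => q Qq e; apply: nb; exists q.
pose TW := munit Q (fun=> 1) f id.
have ITW : I TW.
  have -> : TW = lie T0 W; last exact: ideal_lier.
  apply: glM_eq => b; rewrite lieE [W (T0 _)]WT ?subr0; last first.
    by move=> q Qq; apply: munit_row0 => // p Ep e; case: (Qi q p).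
  have [Qb|nQb] := pselect (Q b);
    last by rewrite !munit0 ?glM_lin0 // => q Qq e;
     apply: nQb; rewrite -e.
  by rewrite -[b]/(id b) !munitE // !scale1r -/(g b) munitE // scale1r.
have -> : psi = lie (glM_comp psi Phi) TW; last exact: ideal_liel.
apply: glM_eq => b; rewrite lieE !glM_compE.
have -> : TW (psi (Phi (v b))) = 0.
  by apply: munit_ker => // q Qq; apply: coord_eq0_on => b'; exact: hQ.
rewrite subr0; have [Qb|nQb] := pselect (Q b).
  by rewrite -[b in RHS]/(id b) /TW munitE // scale1r munitE // scale1r.
rewrite munit0 ?glM_lin0 // => [|q Qq e]; last by apply: nQb; rewrite -e.
by apply: contrapT => /eqP h; apply: nQb; exact: cQ.
Qed.

(** The first components used may collide with the columns of [psi]. Two injections into [E] with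
    disjoint images avoid this: columns outside the set [R] of first components of one injection use
    that one, and columns in [R] use the other, whose first components miss [R]. *)
Lemma ideal_of_pairs (E : set (B * B)) psi :
  inj_on E fst -> inj_on E snd -> (forall p q, E p -> E q -> p.1 <> q.2) ->
  I (munit E (fun=> 1) fst snd) ->
  (cols psi `*` [set: bool] #<= E)%card ->
  (forall b b', cols psi b -> x b (psi (v b')) = 0) -> I psi.
Proof.
move=> finj sinj fs IT hE hpsi.
have [c0|/set0P[b0 _]] := eqVneq (cols psi) set0.
  suff -> : psi = 0 by exact: ideal0.
  apply: glM_eq => b; apply: contrapT => /eqP h.
  by have : cols psi b by []; rewrite c0.
have [h [hE' hinj]] := card_le_fun (b0, b0) hE.
pose Q := cols psi.
pose R b := exists2 q, Q q & b = (h (q, true)).1.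
have QT q c : Q q -> (cols psi `*` [set: bool]) (q, c) by [].
have Ih c : inj_on Q (fun b => h (b, c)).
  by move=> b b' Qb Qb' e; case: (hinj _ _ (QT b c Qb) (QT b' c Qb') e).
pose psi1 := glM_comp psi (diag (indic (~` R)));
  pose psi2 := glM_comp psi (diag (indic R)).
have colsI (A : set B) b : cols (glM_comp psi (diag (indic A))) b -> A b /\ Q b.
  move=> hb; have {hb} : psi (diag (indic A) (v b)) != 0 by exact: hb.
  rewrite diagE glM_linZ scaler_eq0 negb_or => /andP[hA hb].
  by split=> //; exact: indic_neq0 hA.
have -> : psi = psi1 + psi2.
  apply: glM_eq => b; rewrite glM_addE !glM_compE !diagE !glM_linZ -scalerDl.
  have [Rb|Rb] := pselect (R b).
    by rewrite (indicT Rb) indicF ?add0r ?scale1r.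
  by rewrite (indicF Rb) indicT ?addr0 ?scale1r.
have row0 (A : set B) b b' :
  Q b -> x b (glM_comp psi (diag (indic A)) (v b')) = 0.
  by move=> Qb; rewrite glM_compE diagE glM_linZ linearZ /= hpsi // mulr0.
apply: idealD.
  apply: (@ideal_of_pairs_avoiding E (Q `&` ~` R) (fun b => h (b, true))) => //.
  - by move=> b [Qb _]; exact: hE'.
  - by move=> b b' [Qb _] [Qb' _]; exact: Ih.
  - by move=> b q [_ Rb] [Qq _] e; apply: Rb; exists q.
  - by move=> b /colsI[].
  - by move=> b b' [Qb _]; exact: row0.
apply: (@ideal_of_pairs_avoiding E (Q `&` R) (fun b => h (b, false))) => //.
- by move=> b [Qb _]; exact: hE'.
- by move=> b b' [Qb _] [Qb' _]; exact: Ih.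
- move=> b q [_ [q' Qq' ->]] [Qq _] e.
  have := finj _ _ (hE' _ (QT _ true Qq')) (hE' _ (QT _ false Qq)) e.
  by move/(hinj _ _ (QT _ _ Qq') (QT _ _ Qq)).
- by move=> b /colsI[].
- by move=> b b' [Qb _]; exact: row0.
Qed.

(* Eilenberg swindle: an operator [psi] on the span of [E], copied along the
   injection [c], is the commutator of a backward shift with the operator that
   applies [psi] in every copy and shifts it forward. *)
Section Swindle.
Variables (E : set B) (c : B * nat -> B).
Local Notation EN := (E `*` [set: nat]).
Hypotheses (c_inj : inj_on EN c) (c0 : forall e, E e -> c (e, 0%N) = e).
Variable psi : glM x.
Hypotheses (psi_cols : cols psi `<=` E)
  (psi_rows : forall a u, ~ E a -> x a (psi u) = 0).

Let ENI e n : E e -> EN (e, n). Proof. by []. Qed.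

Let shift n : glM x := munit E (fun=> 1) (fun e => c (e, n)) id.
Let shift_inj n : inj_on E (fun e => c (e, n)).
Proof. by move=> e e' Ee Ee' /(c_inj (ENI n Ee) (ENI n Ee'))[]. Qed.
Let id_inj : inj_on E id. Proof. by []. Qed.

Definition forward_copies_fun (b : B) : V :=
  if pselect (exists2 p, EN p & c p = b) is left h
  then shift (s2val (cid2 h)).2.+1 (psi (v (s2val (cid2 h)).1)) else 0.

Lemma forward_copies_funE e n : E e ->
  forward_copies_fun (c (e, n)) = shift n.+1 (psi (v e)).
Proof.
rewrite /forward_copies_fun => Ee; case: pselect => [h|[]];
  last by exists (e, n).
by case: cid2 => p /= ENp /(c_inj ENp (ENI n Ee)) ->.
Qed.

Lemma forward_copies_fun0 b : (forall p, EN p -> c p <> b) ->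
  forward_copies_fun b = 0.
Proof.
by rewrite /forward_copies_fun => h; case: pselect => // -[p ENp e];
  case: (h p).
Qed.

Lemma forward_copies_coord b a : x a (forward_copies_fun b) != 0 ->
  exists e e' n, [/\ E e, E e', b = c (e, n), a = c (e', n.+1)
    & x e' (psi (v e)) != 0].
Proof.
have [[[e n] [/= Ee _] <-]|nb] := pselect (exists2 p, EN p & c p = b);
  last first.
  by rewrite forward_copies_fun0 ?linear0 ?eqxx // => p ENp h; apply: nb;
    exists p.
rewrite forward_copies_funE //.
have [[e' Ee' ea]|na] := pselect (exists2 e', E e' & c (e', n.+1) = a);
  last first.
  rewrite (munit_row0 _ (@shift_inj n.+1) id_inj) ?eqxx // => e' Ee' h.
  by apply: na; exists e'.
rewrite -ea (munit_row _ (@shift_inj n.+1) id_inj) // mul1r => h.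
by exists e, e', n; split.
Qed.

(** A row in copy [m] sees only copy [m.-1], through a single row of [psi]; for [m = 0] it is
    zero. *)
Fact forward_copies_row_finite : row_finite forward_copies_fun.
Proof.
move=> a.
have [[[e' m] [/= Ee' _] ea]|na] := pselect (exists2 p, EN p & c p = a);
  last first.
  suff -> : [set b | x a (forward_copies_fun b) != 0] = set0
    by exact: finite_set0.
  apply/seteqP; split=> b //= /forward_copies_coord[e [e' [n [_ Ee' _ ea _]]]].
  by apply: na; exists (e', n.+1).
apply: (@sub_finite_set _ _
    [set c (e, m.-1) | e in [set e | x e' (psi (v e)) != 0]]); last first.
  by apply: finite_image; exact: glM_row_finite.
move=> b /forward_copies_coord[e [e'' [n [Ee Ee'' -> ea' h]]]].
have := c_inj (ENI m Ee') (ENI n.+1 Ee'') (etrans ea ea').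
by case=> e'e'' ->; exists e => //=; rewrite e'e''.
Qed.

Lemma swindle_ideal :
  (forall phi, (cols phi #<= cols psi `*` [set: nat])%card ->
     (forall b b', cols phi b -> x b (phi (v b')) = 0) -> I phi) -> I psi.
Proof.
move=> hI'; pose S := munit EN (fun=> 1) c (fun p => c (p.1, p.2.+1)).
have s_inj : inj_on EN (fun p => c (p.1, p.2.+1)).
  move=> [e n] [e' n'] [/= Ee _] [/= Ee' _].
  by case/(c_inj (ENI n.+1 Ee) (ENI n'.+1 Ee')) => -> ->.
have [Y YvE] : exists Y : glM x, forall b, Y (v b) = forward_copies_fun b.
  by exists (glM_mk forward_copies_row_finite) => b; rewrite glM_mkE.
have YE e n : E e -> Y (v (c (e, n))) = shift n.+1 (psi (v e)).
  by move=> Ee; rewrite YvE forward_copies_funE.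
have Y0 b : (forall p, EN p -> c p <> b) -> Y (v b) = 0.
  by move=> h; rewrite YvE forward_copies_fun0.
have -> : psi = lie S Y.
  apply: glM_eq => b; rewrite lieE.
  have [[[e n] [/= Ee _] <-]|nb] := pselect (exists2 p, EN p & c p = b);
    last first.
    have nb' p : EN p -> c p <> b by move=> ENp h; apply: nb; exists p.
    rewrite Y0 // glM_lin0 sub0r munit0 ?glM_lin0 ?oppr0; last first.
      by move=> [e n] [/= Ee _]; apply: nb'.
    apply: contrapT => /eqP h; apply: nb; exists (b, 0%N);
      last exact/c0/psi_cols.
    by split=> //; exact: psi_cols.
  have SY : S (Y (v (c (e, n)))) = shift n (psi (v e)).
    rewrite YE //; apply: coord_inj => a.
    have [[[e' m] [/= Ee' _] <-]|na] := pselect (exists2 p, EN p & c p = a);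
      last first.
      rewrite (munit_row0 _ c_inj s_inj); last by move=> p ENp h; apply: na;
        exists p.
      rewrite (munit_row0 _ (@shift_inj n) id_inj) // => e' Ee' h.
      by apply: na; exists (e', n).
    rewrite (munit_row _ c_inj s_inj) //= mul1r.
    have [<-|nm] := eqVneq m n.
      by rewrite (munit_row _ (@shift_inj m.+1) id_inj) // (munit_row _
        (@shift_inj m) id_inj).
    rewrite (munit_row0 _ (@shift_inj n) id_inj); last first.
      move=> e'' Ee'' /(c_inj (ENI n Ee'') (ENI m Ee'))[_ mn].
      by rewrite mn eqxx in nm.
    rewrite (munit_row0 _ (@shift_inj n.+1) id_inj) // =>
      e'' Ee'' /(c_inj (ENI n.+1 Ee'') (ENI m.+1 Ee'))[_ mn].
    by rewrite mn eqxx in nm.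
  (* In copy 0 the shift [S] kills the vector and [psi] remains; in every later copy the two
     products cancel. *)
  rewrite SY; case: n {SY} => [|n].
    rewrite munit0; last first.
      by move=> [e' n] [/= Ee' _] /(c_inj (ENI _ Ee') (ENI _ Ee)).
    rewrite glM_lin0 subr0 c0 //; apply: coord_inj => a.
    have [Ea|na] := pselect (E a); last first.
      rewrite psi_rows // (munit_row0 _ (@shift_inj 0) id_inj) //.
      by move=> e' Ee' h; apply: na; rewrite -h c0.
    by rewrite -{2}(c0 Ea) (munit_row _ (@shift_inj 0) id_inj) // mul1r.
  rewrite (@munitE _ _ _ _ _ c_inj s_inj (e, n)) //= scale1r YE // subrr.
  apply: contrapT => /eqP /psi_cols h.
  by have [] := c_inj (ENI 0 h) (ENI n.+1 Ee) (c0 h).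
apply: ideal_liel.
(* [Y] raises the copy number by one, so its restrictions to odd and to even copies each have
   disjoint rows and columns. *)
pose L (k : bool) : set B := [set b | exists e n, [/\ E e, b = c (e, n) & odd n
  = k]].
pose Yk k := glM_comp Y (diag (indic (L k))).
have YkE k b : Yk k (v b) = indic (L k) b *: Y (v b).
  by rewrite glM_compE diagE glM_linZ.
have -> : Y = Yk true + Yk false.
  apply: glM_eq => b; rewrite glM_addE !YkE -scalerDl.
  have [[[e n] [/= Ee _] eb]|nb] := pselect (exists2 p, EN p & c p = b);
    last first.
    by rewrite Y0 ?scaler0 // => p ENp h; apply: nb; exists p.
  suff -> : indic (L true) b + indic (L false) b = 1 by rewrite scale1r.
  have Lb k : L k b -> odd n = k.
    move=> [e' [n' [Ee' eb' <-]]].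
    by have [_ ->] := c_inj (ENI n Ee) (ENI n' Ee') (etrans eb eb').
  case h : (odd n).
    rewrite indicT ?indicF ?addr0 //; first by move/Lb; rewrite h.
    by exists e, n.
  rewrite indicF ?indicT ?add0r //; last by move/Lb; rewrite h.
  by exists e, n.
suff IYk : forall k, I (Yk k) by exact: idealD.
move=> k; have Ykn b : cols (Yk k) b -> L k b /\ Y (v b) != 0.
  move=> hb; have : Yk k (v b) != 0 by [].
  by rewrite YkE scaler_eq0 negb_or => /andP[/indic_neq0].
apply: hI'.
  apply: (@rel_card_le _ _ _ _ (fun b p => EN p /\ c p = b)).
    move=> b /Ykn[[e [n [Ee eb _]]] Yb]; exists (e, n) => //; split=> //=.
    by apply: contraNneq Yb => h; rewrite eb YE // h glM_lin0.
  by move=> b b' p _ _ [_ <-] [_ <-].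
move=> b b' /Ykn[[e [n [Ee eb on]]] _]; rewrite YkE linearZ /=.
apply: contrapT => /eqP; rewrite mulf_eq0 negb_or => /andP[/indic_neq0].
move=> [e1 [n1 [Ee1 eb1 on1]]]; rewrite YvE.
move=> /forward_copies_coord[e2 [e3 [m [Ee2 Ee3 eb2 eb3 _]]]].
have [_ nm] := c_inj (ENI n Ee) (ENI _ Ee3) (etrans (esym eb) eb3).
have [_ n1m] := c_inj (ENI n1 Ee1) (ENI _ Ee2) (etrans (esym eb1) eb2).
by move: on; rewrite -on1 nm n1m /=; case: odd.
Qed.

End Swindle.

(** Copy 0 is the block on [A] itself; [h] places all later copies outside [A]. *)
Lemma ideal_diagonal_block (A : set B) (h : B * nat -> B) psi :
  injective h -> (forall p, ~ A (h p)) -> cols psi `<=` A ->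
  (forall a u, ~ A a -> x a (psi u) = 0) ->
  (forall phi, (cols phi #<= cols psi `*` [set: nat])%card ->
     (forall b b', cols phi b -> x b (phi (v b')) = 0) -> I phi) -> I psi.
Proof.
move=> hinj hA cA rA.
apply: (@swindle_ideal A (fun p => if p.2 is n.+1 then h (p.1, n) else p.1)) =>
  //.
move=> [e [|n]] [e' [|n']] [/= Ae _] [/= Ae' _] => [->//|ee|ee|/hinj[-> ->]//].
  by case: (hA (e', n')); rewrite -ee.
by case: (hA (e, n)); rewrite ee.
Qed.

Definition block (A A' : set B) psi : glM x :=
  glM_comp (diag (indic A)) (glM_comp psi (diag (indic A'))).

Lemma block_coord (A A' : set B) psi a b :
  x a (block A A' psi (v b)) = indic A a * (indic A' b * x a (psi (v b))).
Proof. by rewrite !glM_compE diag_coord diagE glM_linZ linearZ. Qed.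

Lemma block_cols (A A' : set B) psi b :
  cols (block A A' psi) b -> A' b /\ cols psi b.
Proof.
move=> /coord_neq0[a]; rewrite block_coord !mulf_eq0 !negb_or.
case/and3P => _ /indic_neq0 A'b h; split=> //.
by apply: contraNneq h => ->; rewrite linear0.
Qed.

Lemma block_rows (A A' : set B) psi a u : ~ A a -> x a (block A A' psi u) = 0.
Proof. by move=> h; rewrite glM_compE diag_coord indicF // mul0r. Qed.

Lemma indicC (A : set B) b : indic A b + indic (~` A) b = 1.
Proof.
have [h|h] := pselect (A b); first by rewrite indicT // indicF ?addr0.
by rewrite indicF // indicT ?add0r.
Qed.

Lemma block_sum (A : set B) psi : psi = block A A psi + block A (~` A) psi
  + (block (~` A) A psi + block (~` A) (~` A) psi).
Proof.
apply: glM_eq => b; apply: coord_inj => a; rewrite !glM_addE !linearD /=.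
by rewrite !block_coord -!mulrDr -!mulrDl !indicC !mul1r.
Qed.

(** [A] consists of the even layers of an injection of [B * nat] into [B], so [A] and its complement
    both have room for infinitely many copies of every index. Each diagonal block is swindled into
    the opposite half; the mixed blocks have disjoint rows and columns. *)
Lemma ideal_all_blocks (T : Type) (Ks : set T) :
  infinite_set [set: B] -> infinite_set Ks ->
  (forall phi, (cols phi #<= Ks)%card ->
     (forall b b', cols phi b -> x b (phi (v b')) = 0) -> I phi) ->
  forall psi, (cols psi #<= Ks)%card -> I psi.
Proof.
move=> iB iK hoff psi hpsi; have [b0 _] := infinite_setN0 iB.
have [h [_ hinj']] := card_le_fun b0 (infinite_mul_nat iB).
have hinj : injective h by move=> p q e; exact: hinj'.
pose A : set B := [set b | exists p : B * nat, b = h (p.1, p.2.*2)].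
have hoff' chi : (cols chi #<= Ks)%card ->
    forall phi, (cols phi #<= cols chi `*` [set: nat])%card ->
     (forall b b', cols phi b -> x b (phi (v b')) = 0) -> I phi.
  move=> hchi phi hphi; apply: hoff; apply: card_le_trans hphi _.
  by apply: card_le_trans (card_leX _ hchi) _; exact: infinite_mul_nat.
have hb A1 A2 : (cols (block A1 A2 psi) #<= Ks)%card.
  by apply: card_le_trans hpsi; apply: subset_card_le => b /block_cols[].
rewrite (block_sum A psi); apply: idealD; apply: idealD.
- apply: (@ideal_diagonal_block A (fun p => h (p.1, p.2.*2.+1))) => //.
  + by move=> [b n] [b' n'] /hinj[-> /double_inj ->].
  + by move=> [b n] [[b' n'] /hinj[_ /(congr1 odd)]]; rewrite /= !odd_double.
  + by move=> b /block_cols[].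
  + by move=> a u; exact: block_rows.
  + exact: hoff'.
- apply: hoff => // b b' /block_cols[Ab _]; exact: block_rows.
- apply: hoff => // b b' /block_cols[Ab _]; apply: block_rows; exact.
- apply: (@ideal_diagonal_block (~` A) (fun p => h (p.1, p.2.*2))) => //.
  + by move=> [b n] [b' n'] /hinj[-> /double_inj ->].
  + by move=> p; apply; exists p.
  + by move=> b /block_cols[].
  + by move=> a u; exact: block_rows.
  + exact: hoff'.
Qed.

Lemma ideal_aleph (T : Type) (Ks : set T) s phi : (2%:R : K) != 0 ->
  infinite_set [set: B] -> has_aleph s Ks -> I phi ->
  (forall c, ~ lt_aleph s (cols (phi - c *: glM_id x))) ->
  forall psi, (cols psi #<= Ks)%card -> I psi.
Proof.
move=> h2 iB aK Iphi nphi; have iK := has_aleph_infinite aK.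
have [E hE ltE] := ex_sparse_pairs phi.
have KE : (Ks #<= E)%card.
  apply: contrapT => nKE; have [|c] := ltE s; first exact/(lt_alephP _ aK).
  exact: nphi.
apply: (ideal_all_blocks iB iK) => psi hpsi.
apply: (@ideal_of_pairs E).
- exact: sparse_fst hE.
- exact: sparse_snd hE.
- exact: sparse_disjoint hE.
- exact: sparse_munit hE h2 Iphi.
(* Two copies of the columns are required, and the infinite [Ks] absorbs the doubling. *)
apply: card_le_trans KE; apply: card_le_trans (infinite_mul_nat iK).
apply: card_le_trans (card_leX _ hpsi).
apply: (@fun_card_le _ _ _ _ (fun p => (p.1, nat_of_bool p.2))) => //.
by move=> [b []] [b' []] _ _ [->].
Qed.

(** * Operators with finitely many nonzero columns *)

Lemma glM_sumE (J : Type) (s : seq J) (F : J -> glM x) u :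
  (\sum_(j <- s) F j) u = \sum_(j <- s) F j u.
Proof.
by elim: s => [|j s IH]; rewrite ?big_nil // !big_cons glM_addE IH.
Qed.

Fact mackey_rank1 (w : V) b : (fun u => x b u *: w) \in mackey x.
Proof.
apply/mackeyP; split=> [a u u'|y y' hy e].
  by rewrite linearP /= scalerDl scalerA.
apply: (Vlow_comb (a := y w) (b := 0) (Vlow_dual b) (Vlow_dual b)) => u.
by rewrite e linearZ /= mul0r addr0 mulrC.
Qed.

Definition rank1 (w : V) b : glM x := GlM (mackey_rank1 w b).

Lemma rank1E w b u : rank1 w b u = x b u *: w. Proof. by []. Qed.

Lemma lie_rank1 w b w' b' : (lie (rank1 w b) (rank1 w' b') : glM x) =
  x b w' *: rank1 w b' - x b' w *: rank1 w' b.
Proof.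
apply: glM_eq => d; rewrite lieE glM_subE !glM_scaleE !rank1E !linearZ /=
  !scalerA.
by rewrite [x b' w * _]mulrC.
Qed.

(** If the nonzero entry found is diagonal, at [b], a zero column [d] exists because [B] is
    infinite, and the diagonal entries at [b] and [d] differ. A single pair is trivially sparse. *)
Lemma ideal_matrix_unit phi : (2%:R : K) != 0 -> infinite_set [set: B] ->
  I phi -> finite_set (cols phi) -> phi <> 0 ->
  exists a b, a <> b /\ I (rank1 (v a) b).
Proof.
move=> h2 iB Iphi fphi phi0.
have [b hb] : exists b, cols phi b.
  apply: contrapT => /forallNP h; apply: phi0; apply: glM_eq => b.
  by apply: contrapT => /eqP /h.
have [p gp] : exists p, good_pair phi p.
  have [a ab] := coord_neq0 hb; have [e|ne] := eqVneq a b; last first.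
    by exists (a, b); split; [exact/eqP|left; exact/eqP].
  have [d hd] : exists d, ~ cols phi d.
    apply: contrapT => /forallNP h; apply: iB;
      apply: sub_finite_set fphi => d _.
    exact: contrapT (h d).
  exists (b, d); split; first by move=> /= bd; apply: hd; rewrite -bd.
  right; rewrite /= -{1}e; have -> : phi (v d) = 0 by apply: contrapT =>
    /eqP /hd.
  by rewrite linear0; exact/eqP.
have hE : sparse_pairs phi [set p].
  by split=> [_ -> //|p1 p2 a -> ->|p1 p2 a b' -> ->].
exists p.1, p.2; split; first by case: gp.
suff -> : rank1 (v p.1) p.2 = munit [set p] (fun=> 1) fst snd.
  exact: (sparse_munit hE h2 Iphi).
have [fi si] := (sparse_fst hE, sparse_snd hE).
apply: glM_eq => d; rewrite rank1E x_dual; have [->|ne] := eqVneq d p.2.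
  by rewrite (munitE _ fi si).
rewrite scale0r munit0 // => _ -> e; by rewrite e eqxx in ne.
Qed.

(** From [U a b], commutators with [U c a] change the row and commutators with [U b d] the column;
    the remaining row [b] is reached through a third index [e]. Diagonal units are corrected at the
    fixed place [o], which is [b], and linearity gives general [w]. *)
Lemma ideal_traceless_rank1 phi : (2%:R : K) != 0 -> infinite_set [set: B] ->
  I phi -> finite_set (cols phi) -> phi <> 0 ->
  exists o, forall w b, I (rank1 w b - x b w *: rank1 (v o) o).
Proof.
move=> h2 iB Iphi fphi phi0.
have [a [b [ab Iab]]] := ideal_matrix_unit h2 iB Iphi fphi phi0.
pose U c d := rank1 (v c) d.
have IU1 c : I (U c b - (c == b)%:R *: U a a).
  have := ideal_liel (U c a) Iab; rewrite lie_rank1 !x_dual eqxx scale1r.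
  by [].
have IU2 c d : c <> b -> I (U c d - (c == d)%:R *: U b b).
  move=> cb; have := IU1 c; have [//|_] := eqVneq c b.
  rewrite scale0r subr0 => Icb; have := ideal_lier (U b d) Icb.
  by rewrite lie_rank1 !x_dual eqxx scale1r.
have IU3 d : I (U b d - (b == d)%:R *: U b b).
  have [<-|bd] := eqVneq b d; first by rewrite scale1r subrr; exact: ideal0.
  have [e /not_orP[eb ed]] : exists e, ~ (e = b \/ e = d).
    apply: contrapT => /forallNP h; apply: iB.
    by apply: sub_finite_set (finite_set2 b d) => e _; exact: contrapT (h e).
  have := IU2 e d eb; have [//|_] := eqVneq e d.
  rewrite scale0r subr0 => /(ideal_liel (U b e)).
  rewrite lie_rank1 !x_dual eqxx scale1r (negPf bd) scale0r subr0.
  by [].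
have IU c d : I (U c d - (c == d)%:R *: U b b).
  by have [->|/eqP cb] := eqVneq c b; [exact: IU3|exact: IU2].
exists b => w d.
have -> : rank1 w d - x d w *: rank1 (v b) b =
    \sum_(c <- supp w) x c w *: (U c d - (c == d)%:R *: U b b).
  have hs c : x c w != 0 -> c \in supp w by rewrite mem_supp.
  apply: glM_ext => u; rewrite glM_sumE.
  under eq_bigr do rewrite glM_scaleE glM_subE glM_scaleE !rank1E scalerBr.
  rewrite sumrB glM_subE glM_scaleE !rank1E; congr (_ - _).
    rewrite {1}(basis_sum (uniq_supp w) hs) scaler_sumr; apply: eq_bigr => c _.
    by rewrite !scalerA mulrC.
  rewrite (scalar_sum (x d) (uniq_supp w) hs) scaler_suml;
    apply: eq_bigr => c _.
  by rewrite x_dual -!scalerA.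
by apply: ideal_sum => c; exact: idealZ.
Qed.

Lemma cols_sum phi u (s : seq B) :
  uniq s -> (forall b, cols phi b -> b \in s) ->
  phi u = \sum_(b <- s) x b u *: phi (v b).
Proof.
move=> us hs; have hu b : x b u != 0 -> b \in supp u by rewrite mem_supp.
rewrite {1}(basis_sum (uniq_supp u) hu) linear_sum /=.
rewrite (eq_bigr (fun b => x b u *: phi (v b))) => [|b _]; last exact: glM_linZ.
apply: sum_supp_eq; rewrite ?uniq_supp // => b;
  rewrite scaler_eq0 negb_or => /andP[].
  by move=> /hu.
by move=> _ /hs.
Qed.

(** Each column of [psi] is corrected by its diagonal entry at [o]; the corrections add up to the
    trace, which is 0. *)
Lemma ideal_traceless phi psi (s : seq B) : (2%:R : K) != 0 ->
  infinite_set [set: B] -> I phi -> finite_set (cols phi) -> phi <> 0 ->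
  uniq s -> (forall b, cols psi b -> b \in s) -> \sum_(b <- s) x b (psi (v b))
    = 0 ->
  I psi.
Proof.
move=> h2 iB Iphi fphi phi0 us hs tr0.
have [o ho] := ideal_traceless_rank1 h2 iB Iphi fphi phi0.
have -> : psi = \sum_(b <- s)
    (rank1 (psi (v b)) b - x b (psi (v b)) *: rank1 (v o) o).
  apply: glM_ext => u; rewrite glM_sumE.
  under eq_bigr do rewrite glM_subE glM_scaleE !rank1E.
  by rewrite sumrB -scaler_suml tr0 scale0r subr0; exact: cols_sum.
by apply: ideal_sum.
Qed.

End Ideals.

(** * The terms of the filtration are submodules *)

Lemma cols_lin a phi psi : cols (a *: phi + psi) `<=` cols phi `|` cols psi.
Proof.
move=> b hb; apply: contrapT => /not_orP[h1 h2].
have e1 : phi (v b) = 0 by apply: contrapT => /eqP.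
have e2 : psi (v b) = 0 by apply: contrapT => /eqP.
have : (a *: phi + psi) (v b) != 0 by exact: hb.
by rewrite glM_addE glM_scaleE e1 e2 scaler0 addr0 eqxx.
Qed.

(** Beyond the columns of [phi], only a [b] for which [g (v b)] meets such a column contributes.
    Finiteness of the rows of [g] keeps this below the same aleph. *)
Lemma cols_lie (g : glM x) phi : cols (lie g phi) `<=`
  cols phi `|` \bigcup_(a in cols phi) [set b | x a (g (v b)) != 0].
Proof.
move=> b hb; have [|h0] := pselect (cols phi b); [by left|right].
apply: contrapT => h1; have {hb} : (lie g phi : glM x) (v b) != 0 by exact: hb.
rewrite lieE; have -> : phi (v b) = 0 by apply: contrapT => /eqP.
rewrite glM_lin0 sub0r oppr_eq0 => /coord_neq0[d]; apply/negP; rewrite negbK.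
rewrite coord_linear big1 // => a _; apply/eqP; rewrite mulf_eq0.
have [//|h2] := eqVneq (x a (g (v b))) 0.
have [->|h3] := eqVneq (phi (v a)) 0; first by rewrite linear0 eqxx.
by case: h1; exists a.
Qed.

(** Evaluation of a tensor is the trace of its operator: over a list containing the columns and the
    supports of all [w i], exchanging two finite sums identifies them. *)
Lemma slVP phi : slV x phi <-> exists s : seq B, [/\ uniq s,
  forall b, cols phi b -> b \in s & \sum_(b <- s) x b (phi (v b)) = 0].
Proof.
split=> [[n [w [y [hy e tr0]]]]|[s [us hs tr0]]]; last first.
  pose e (i : 'I_(size s)) := tnth (in_tuple s) i.
  exists (size s), (fun i => phi (v (e i))), (fun i => x (e i)); split.
  - by move=> i; exact: Vlow_dual.
  - by move=> u; rewrite (cols_sum u us hs) big_tnth.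
  - by rewrite -[RHS]tr0 [RHS]big_tnth.
have fc : finite_set (cols phi).
  apply: (@sub_finite_set _ _ (\bigcup_(i in [set:
    'I_n]) [set b | y i (v b) != 0])).
    move=> b hb; apply: contrapT => h; move/eqP: hb; apply.
    rewrite e big1 // => i _; have [->|h'] := eqVneq (y i (v b)) 0.
      by rewrite scale0r.
    by case: h; exists i.
  by apply: bigcup_finite => // i _; exact/VlowP.
have [s0 e0] := (finite_seqP (cols phi)).1 fc.
pose s := undup (s0 ++ flatten [seq supp (w i) | i <- enum 'I_n]).
exists s; split; first exact: undup_uniq.
  by move=> b hb; rewrite mem_undup mem_cat; move: hb; rewrite e0 => ->.
rewrite -[RHS]tr0.
rewrite (eq_bigr (fun b => \sum_(i < n) x b (w i) * y i (v b))); last first.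
  move=> b _; rewrite e linear_sum; apply: eq_bigr => i _.
  by rewrite linearZ /= mulrC.
rewrite exchange_big /=; apply: eq_bigr => i _.
rewrite (@scalar_sum (y i) (w i) s) //; first exact: undup_uniq.
move=> b hb; rewrite mem_undup mem_cat; apply/orP; right.
by apply/flattenP; exists (supp (w i)); [apply: map_f;
  rewrite mem_enum|rewrite mem_supp].
Qed.

Lemma trace_indep phi (s s' : seq B) : uniq s -> uniq s' ->
  (forall b, cols phi b -> b \in s) -> (forall b, cols phi b -> b \in s') ->
  \sum_(b <- s) x b (phi (v b)) = \sum_(b <- s') x b (phi (v b)).
Proof.
move=> us us' hs hs'.
have h b : x b (phi (v b)) != 0 -> cols phi b.
  by apply: contraNneq => ->; rewrite linear0.
by apply: sum_supp_eq => // b /h; [exact: hs|exact: hs'].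
Qed.

Lemma slV_finite phi : slV x phi -> finite_set (cols phi).
Proof.
move=> /slVP[s [_ hs _]]; apply: sub_finite_set (finite_seq s) => b; exact: hs.
Qed.

(** Both products have the same trace once [s] contains the columns of [phi], those of the
    commutator, and the supports of the columns of [phi]: the two traces are then one finite double
    sum. *)
Lemma slV_lie (g : glM x) phi : finite_set (cols phi) -> slV x (lie g phi).
Proof.
move=> fc; apply/slVP.
have fl : finite_set (cols phi `|` \bigcup_(a in cols phi) [set b | x a (g (v
  b)) != 0]).
  rewrite finite_setU; split=> //; apply: bigcup_finite => // a _.
  exact: glM_row_finite.
have [s0 e0] := (finite_seqP _).1 fl.
pose s := undup (s0 ++ flatten [seq supp (phi (v b)) | b <- s0]).
have us : uniq s by exact: undup_uniq.
have hs0 b : (cols phi `|` \bigcup_(a in cols phi) [set b | x a (g (v b)) !=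
  0]) b ->
    b \in s0 by rewrite e0.
have hs b : cols phi b -> b \in s.
  by move=> h; rewrite mem_undup mem_cat hs0 //; left.
have hsupp a b : x a (phi (v b)) != 0 -> a \in s.
  move=> h; rewrite mem_undup mem_cat; apply/orP; right; apply/flattenP.
  exists (supp (phi (v b))); last by rewrite mem_supp.
  by apply: map_f; apply: hs0; left; apply: contraNneq h => h;
    rewrite /= h linear0.
exists s; split=> // [b /cols_lie h|]; first by rewrite mem_undup mem_cat hs0.
under eq_bigr do rewrite lieE linearB /=.
rewrite sumrB; apply/eqP; rewrite subr_eq0; apply/eqP.
transitivity (\sum_(b <- s) \sum_(a <- s) x a (phi (v b)) * x b (g (v a))).
  apply: eq_bigr => b _.
  exact: (scalar_sum (dual_end g (x b)) us (fun a => @hsupp a b)).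
rewrite exchange_big /=; apply: eq_bigr => b _.
rewrite (cols_sum (g (v b)) us hs) linear_sum; apply: eq_bigr => a _.
by rewrite linearZ /= mulrC.
Qed.

Lemma slV_submodule : submodule (slV x : set gl).
Proof.
split.
- apply/slVP; exists [::]; split; rewrite ?big_nil // => b.
  by rewrite /cols /= eqxx.
- move=> a phi psi hphi hpsi; apply/slVP.
  have fU : finite_set (cols phi `|` cols psi).
    by rewrite finite_setU; split; exact: slV_finite.
  have [s0 e0] := (finite_seqP _).1 fU; pose s := undup s0.
  have us : uniq s by exact: undup_uniq.
  have hs b : (cols phi `|` cols psi) b -> b \in s by rewrite e0 mem_undup.
  have [[s1 [us1 hs1 tr1]] [s2 [us2 hs2 tr2]]] := ((slVP phi).1 hphi, (slVP
    psi).1 hpsi).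
  exists s; split=> // [b /cols_lin|]; first exact: hs.
  transitivity (a * (\sum_(b <- s) x b (phi (v b))) + \sum_(b <- s) x b (psi (v
    b))).
    rewrite mulr_sumr -big_split /=; apply: eq_bigr => b _.
    by rewrite -linearP.
  rewrite (trace_indep us us1) // => [|b hb]; last by apply: hs; left.
  rewrite tr1 mulr0 add0r (trace_indep us us2) // => b hb; by apply: hs; right.
- by move=> g phi hphi; apply: slV_lie; exact: slV_finite.
Qed.

Lemma glM_ideal_submodule s (T : Type) (Ks : set T) : has_aleph s Ks ->
  submodule (glM_ideal v s : set gl).
Proof.
move=> aK; split.
- apply/glM_idealP; apply: (finite_lt_aleph aK).
  apply: sub_finite_set (finite_set0 B) => b hb.
  by have : (0 : glM x) (v b) != 0; [exact: hb|rewrite glM_zeroE eqxx].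
- move=> a phi psi /glM_idealP hphi /glM_idealP hpsi; apply/glM_idealP.
  exact: lt_aleph_sub (@cols_lin _ _ _) (lt_alephU hphi hpsi).
- move=> g phi /glM_idealP hphi; apply/glM_idealP.
  apply: lt_aleph_sub (@cols_lie g phi) _; apply: lt_alephU => //.
  by apply: lt_aleph_bigcup => // a _; exact: glM_row_finite.
Qed.

Lemma scalar_submodule : submodule ([set c *: glM_id x | c in setT] : set gl).
Proof.
split.
- by exists 0 => //; rewrite scale0r.
- move=> a _ _ [c _ <-] [d _ <-]; exists (a * c + d) => //.
  by rewrite scalerDl scalerA.
- move=> g _ [c _ <-]; exists 0 => //; rewrite scale0r; apply: glM_eq => b.
  apply/esym; change ((lie g (c *: glM_id x) : glM x) (v b) = 0).
  by rewrite lieE !glM_scaleE !glM_idE glM_linZ subrr.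
Qed.

(** * The radical filtration *)

Section Filtration.
Variable t : nat.
Hypotheses (h2 : (2%:R : K) != 0) (dimV : has_aleph t [set: B]).

Let iB : infinite_set [set: B]. Proof. exact: has_aleph_infinite dimV. Qed.

Let alephs s : (s <= t)%N -> exists U (Ks :
  set U), has_aleph s Ks /\ (Ks #<= [set: B])%card.
Proof. by move=> st; exact: has_aleph_below dimV. Qed.

Lemma not_lt_alephT s : (s <= t)%N -> ~ lt_aleph s [set: B].
Proof.
by move=> /alephs[U [Ks [aK KB]]] /(lt_alephP _ aK).
Qed.

Lemma glM_id_notin s : (s <= t)%N -> ~ glM_ideal v s (glM_id x).
Proof.
move=> /not_lt_alephT h /glM_idealP; have -> // : cols (glM_id x) = setT.
apply/seteqP; split=> // b _; rewrite /cols /=.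
by apply/eqP => /(congr1 (x b)) /eqP; rewrite x_dual eqxx linear0 oner_eq0.
Qed.

Lemma submodule_ideal s : (s <= t)%N -> submodule (glM_ideal v s : set gl).
Proof. by move=> /alephs[U [Ks [aK _]]]; exact: glM_ideal_submodule aK. Qed.

Lemma glM_ideal_step s I phi : (s <= t)%N -> submodule (I : set gl) -> I phi ->
  (forall c, ~ glM_ideal v s (phi - c *: glM_id x)) ->
  forall U (Ks : set U), has_aleph s Ks ->
  forall psi, (cols psi #<= Ks)%card -> I psi.
Proof.
move=> st hI Iphi nphi U Ks aK psi hpsi.
apply: (ideal_aleph hI h2 iB aK Iphi _ hpsi) => c /glM_idealP; exact: nphi.
Qed.

Lemma glM_ideal_largest s : (s < t)%N ->
  largest_proper_submodule (glM_ideal v s.+1 : set gl) (glM_ideal v s).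
Proof.
move=> st; have [U [Ks [aK KB]]] := alephs (ltnW st).
have [W [L [aL _]]] := alephs st.
have hN := submodule_ideal st; have hZ := submodule_ideal (ltnW st).
have ZN : glM_ideal v s `<=` @glM_ideal _ _ _ x v s.+1.
  move=> phi /glM_idealP h; apply/glM_idealP; apply: (card_le_lt_alephS aK aL).
  exact: lt_aleph_le h.
split=> //.
  (* Strictness: the projection onto aleph_s basis vectors lies in the larger ideal only. *)
  move: KB => /card_subP[C CK _] /(_ (diag (indic C))).
  have cC : cols (diag (indic C)) = C.
    apply/seteqP; split=> b.
      move=> hb; have {hb} : diag (indic C) (v b) != 0 by exact: hb.
      by rewrite diagE scaler_eq0 negb_or => /andP[/indic_neq0].
    move=> Cb; have : diag (indic C) (v b) != 0; last by [].
    rewrite diagE indicT // scale1r; apply/eqP => /(congr1 (x b)) /eqP.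
    by rewrite x_dual eqxx linear0 oner_eq0.
  move: CK => /card_eqPle[CK KC] h.
  have /h /glM_idealP : glM_ideal v s.+1 (diag (indic C)).
    by apply/glM_idealP; rewrite cC; exact: (card_le_lt_alephS aK aL).
  by rewrite cC => /(lt_alephP _ aK).
move=> P hP PN /existsNP[phi /not_implyP[Pphi nphi]] psi /glM_idealP hpsi.
apply: (glM_ideal_step (ltnW st) hP Pphi _ aK); last exact: lt_alephS hpsi.
(* A nonzero [c] would put the identity into a proper ideal, since [phi] and [phi - c *: glM_id x]
   both lie in the larger one. *)
move=> c hc; have [c0|c0] := eqVneq c 0.
  by move: hc; rewrite c0 scale0r subr0.
apply: (glM_id_notin st).
have := submodB hN (PN _ Pphi) (ZN _ hc); rewrite opprB addrC subrK => hcid.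
by have := submodZ c^-1 hN hcid; rewrite scalerA mulVf // scale1r.
Qed.

(** A submodule not inside sl contains every traceless operator, being nonzero, and also an operator
    of nonzero trace. A multiple of the latter adjusts the trace of any [psi]. *)
Lemma glM_finite_largest :
  largest_proper_submodule (glM_ideal v 0 : set gl) (slV x).
Proof.
have hN := submodule_ideal (leq0n t).
have fin phi : glM_ideal v 0 phi -> finite_set (cols phi).
  by move=> /glM_idealP/lt_aleph0P.
split=> //.
- exact: slV_submodule.
- by move=> phi /slV_finite h; apply/glM_idealP/lt_aleph0P.
- have [o _] := infinite_setN0 iB; pose U := rank1 (v o) o.
  have cU b : cols U b -> b \in [:: o].
    move=> hb; have {hb} : U (v b) != 0 by exact: hb.
    by rewrite rank1E x_dual inE; have [//|_] := eqVneq b o;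
      rewrite scale0r eqxx.
  move=> /(_ U) h; have /h /slVP[s [us hs]] : glM_ideal v 0 U.
    apply/glM_idealP/lt_aleph0P; apply: sub_finite_set (finite_seq [:: o]) => b.
    exact: cU.
  rewrite (@trace_indep U s [:: o]) // big_seq1 rank1E linearZ /= !x_dual eqxx.
  by rewrite mulr1 => /eqP; rewrite oner_eq0.
move=> P hP PN /existsNP[phi /not_implyP[Pphi nphi]] psi /fin fpsi.
have fphi := fin _ (PN _ Pphi).
have phi0 : phi <> 0 by move=> e; apply: nphi; rewrite e;
  exact: submod0 slV_submodule.
have fU : finite_set (cols phi `|` cols psi) by rewrite finite_setU.
have [s0 e0] := (finite_seqP _).1 fU; pose s := undup s0.
have us : uniq s by exact: undup_uniq.
have hs b : (cols phi `|` cols psi) b -> b \in s by rewrite e0 mem_undup.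
pose tr (chi : glM x) := \sum_(b <- s) x b (chi (v b)).
have tr0 : tr phi != 0.
  apply/eqP => h; apply: nphi; apply/slVP; exists s; split=> // b hb.
  by apply: hs; left.
have Pd : P (- (tr psi / tr phi) *: phi + psi).
  apply: (ideal_traceless hP h2 iB Pphi fphi phi0 us) => [b /cols_lin|];
    first exact: hs.
  transitivity (- (tr psi / tr phi) * tr phi + tr psi).
    rewrite mulr_sumr -big_split /=; apply: eq_bigr => b _.
    by rewrite -linearP.
  by rewrite mulNr divfK // addNr.
have := submodB hP Pd (submodZ (- (tr psi / tr phi)) hP Pphi).
by rewrite addrC addKr.
Qed.

Lemma glM_top_largest : largest_proper_submodule ([set: glM x] : set gl)
  [set a + b | a in [set c *: glM_id x | c in setT] & b in glM_ideal v t].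
Proof.
have [U [Ks [aK KB]]] := alephs (leqnn t).
have hN := submodule_ideal (leqnn t).
split.
- exact: submoduleT.
- exact: submodule_addset scalar_submodule hN.
- by [].
- have [b0 _] := infinite_setN0 iB.
  have [h [_ hinj]] := card_le_fun b0 (infinite_mul_nat iB).
  (* [A 0] and [A 1] are disjoint and of full size. The projection onto [A 0] has eigenvalue 1 on
     the first and 0 on the second, so it differs from any scalar on aleph_t columns. *)
  pose A n := [set h (b, n) | b in [set: B]].
  have BA n : ([set: B] #<= A n)%card.
    apply: (@fun_card_le _ _ _ _ (fun b => h (b, n))) => [b _|b b' _ _ e].
      by exists b.
    by have [] := hinj (b, n) (b', n) (conj I I) (conj I I) e.
  pose phi := diag (indic (A 0%N)).
  move=> /(_ phi I)[_ [c _ <-] [psi /glM_idealP hpsi e]].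
  have psiE b : psi (v b) = (indic (A 0%N) b - c) *: v b.
    rewrite scalerBl -diagE -/phi -e glM_addE glM_scaleE glM_idE addrAC subrr
      add0r.
    by [].
  have sub n : (forall b, A n b -> indic (A 0%N) b - c != 0) -> False.
    move=> hn; apply: (not_lt_alephT (leqnn t)).
    apply: lt_aleph_card_le (BA n) _; apply: lt_aleph_sub hpsi => b /hn hb.
    have : psi (v b) != 0; last by [].
    rewrite psiE scaler_eq0 negb_or hb /=; apply/eqP => /(congr1 (x b)) /eqP.
    by rewrite x_dual eqxx linear0 oner_eq0.
  have [c1|c1] := eqVneq c 1.
    apply: (sub 1%N) => b [b' _ eb];
      rewrite indicF ?c1 ?sub0r ?oppr_eq0 ?oner_eq0 //.
    move=> [b'' _ eb'']; have := hinj (b', 1%N) (b'', 0%N) (conj I I) (conj I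
      I).
    by rewrite eb eb'' => /(_ erefl).
  by apply: (sub 0%N) => b Ab; rewrite indicT // subr_eq0 eq_sym.
move=> P hP _ /existsNP[phi /not_implyP[Pphi nphi]] psi _.
apply: (glM_ideal_step (leqnn t) hP Pphi _ dimV); last exact: card_leT.
move=> c hc; apply: nphi; exists (c *: glM_id x); first by exists c.
by exists (phi - c *: glM_id x) => //; rewrite addrC subrK.
Qed.

Lemma radn1 : radn gl 1 =
  [set a + b | a in [set c *: glM_id x | c in setT] & b in glM_ideal v t].
Proof. exact: rad_eq glM_top_largest. Qed.

Lemma radnS q : radn gl q.+1 = Defs.rad (radn gl q). Proof. by []. Qed.

Lemma radn2 Z : largest_proper_submodule (glM_ideal v t :
  set gl) Z -> radn gl 2 = Z.
Proof.
move=> hZ; rewrite radnS radn1; apply: rad_line_add => //.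
  exact: scalar_submodule.
exact: glM_id_notin.
Qed.

Theorem radical_filtration :
  [/\ is_direct_sum (radn gl 1) [set c *: glM_id x | c in setT] (glM_ideal v t),
      forall s : nat, (1 <= s <= t)%N -> radn gl s.+1 = glM_ideal v (t - s)
    & radn gl t.+2 = slV x].
Proof.
have radS s : (1 <= s <= t)%N -> radn gl s.+1 = glM_ideal v (t - s).
  elim: s => [//|[|s] IH] /andP[_ st].
    have e : t = (t - 1).+1 by rewrite subn1 prednK.
    apply: radn2; rewrite {1}e; apply: glM_ideal_largest.
    by rewrite {2}e.
  rewrite radnS IH ?(ltnW st) //.
  have e : (t - s.+1 = (t - s.+2).+1)%N by rewrite subnSK.
  rewrite e; apply: rad_eq; apply: glM_ideal_largest.
  by rewrite -e leq_subr.
split=> //.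
  split; first exact: radn1.
  apply/seteqP; split=> [_ [[c _ <-] h]|_ ->]; last first.
    by split; [exists 0 => //; rewrite scale0r|exact:
      submod0 (submodule_ideal _)].
  have [->|c0] := eqVneq c 0; first by rewrite scale0r.
  case: (@glM_id_notin t (leqnn t)).
  have := submodZ c^-1 (submodule_ideal (leqnn t)) h.
  by rewrite scalerA mulVf // scale1r.
(* For [t = 0] the last radical is also the one that removes the scalars. *)
have [t0|t0] := posnP t.
  by rewrite t0; apply: radn2; rewrite t0; exact: glM_finite_largest.
by rewrite radnS radS ?t0 ?leqnn // subnn; apply: rad_eq;
  exact: glM_finite_largest.
Qed.

End Filtration.
End Basis.

Theorem corollary2p7 (R : realType) (V : lmodType R[i]) (B : choiceType)
    (v : B -> V) (x : B -> {scalar V}) (t : nat)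
    (v_basis : is_basis v) (x_dual : dual_family v x)
    (dimV : has_aleph t [set: B]) :
  let gl : lieModType (glM x) := adjoint (glM x) in
  [/\ is_direct_sum (radn gl 1) [set c *: glM_id x | c in setT] (glM_ideal v t),
      forall s : nat, (1 <= s <= t)%N -> radn gl s.+1 = glM_ideal v (t - s)
    & radn gl t.+2 = slV x].
Proof.
move=> gl; apply: (radical_filtration v_basis x_dual _ dimV).
by rewrite Num.Theory.pnatr_eq0.
Qed.
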